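(* Let $\omega$ be a continuous $2$-cocycle on the Hausdorff locally compact $\sigma$-compact groupoid $\Xi$ with right Haar system $\{\lambda_x\mid x\in X\}$ and unit space $X$. Assume that there is a dense orbit $M\subset X$. For every $x\in M$ the regular representation $\Pi_x:{\sf C}^*_{\rm r}(\Xi,\omega)\to\mathbb B\big[L^2(\Xi_x;\lambda_x)\big]$ is faithful. If ${\sf C}^*_{\rm r}(\Xi,\omega)$ is not unital, the extension $\Pi_x^{\bf M}:{\sf C}^*_{\rm r}(\Xi,\omega)^{\bf M}\to\mathbb B\big[L^2(\Xi_x;\lambda_x)\big]$ to the multiplier $C^*$-algebra is also faithful.
   Context: Groupoid conventions: ${\rm d},{\rm r}:\Xi\to X$ are the source and range maps, $\Xi^{(2)}=\{(\xi,\eta)\mid {\rm d}(\xi)={\rm r}(\eta)\}$ the composable pairs, $\Xi_x={\rm d}^{-1}(\{x\})$, the orbit of $x\in X$ is $\mathcal O_x={\rm r}(\Xi_x)$. A right Haar system is a family of positive regular Borel measures $\{\lambda_x\mid x\in X\}$ with $\lambda_x$ of full support on $\Xi_x$, such that $x\mapsto\int_{\Xi_x} f\,d\lambda_x$ is continuous for every $f\in C_{\rm c}(\Xi)$, and such that for each $\xi\in\Xi$ the homeomorphism $\Xi_{{\rm r}(\xi)}\ni\eta\mapsto\eta\xi\in\Xi_{{\rm d}(\xi)}$ transports $\lambda_{{\rm r}(\xi)}$ to $\lambda_{{\rm d}(\xi)}$. A continuous $2$-cocycle is a continuous $\omega:\Xi^{(2)}\to\mathbb T$ with $\omega(\xi,\eta)\omega(\xi\eta,\zeta)=\omega(\eta,\zeta)\omega(\xi,\eta\zeta)$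 for $(\xi,\eta),(\eta,\zeta)\in\Xi^{(2)}$ and $\omega(x,\eta)=1=\omega(\xi,x)$ whenever $x\in X$, ${\rm r}(\eta)=x={\rm d}(\xi)$. $C_{\rm c}(\Xi)$ is a $*$-algebra with $(f\star_\omega g)(\xi)=\int_{\Xi}f(\xi\eta^{-1})g(\eta)\,\omega(\xi\eta^{-1},\eta)\,d\lambda_{{\rm d}(\xi)}(\eta)$ and $f^{\star_\omega}(\xi)=\overline{\omega(\xi,\xi^{-1})}\,\overline{f(\xi^{-1})}$. The regular representation at $x$ is $\Pi_x(f)u:=f\star_\omega u$ for $f\in C_{\rm c}(\Xi)$, $u\in L^2(\Xi_x;\lambda_x)$. The reduced twisted $C^*$-algebra ${\sf C}^*_{\rm r}(\Xi,\omega)$ is the completion of $C_{\rm c}(\Xi)$ in the norm $\|f\|=\sup_{x\in X}\|\Pi_x(f)\|$, and $\Pi_x$ extends to it by continuity. $\mathscr C^{\bf M}$ denotes the multiplier algebra of a $C^*$-algebra $\mathscr C$, and $\Pi_x^{\bf M}$ the canonical extension of $\Pi_x$ to it. *)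

(* Defs.v *)
From HB Require Import structures.
From mathcomp Require Import all_boot all_order all_algebra.
From mathcomp Require Import all_classical all_reals all_analysis.
From mathcomp Require Import measurable_realfun complex.

Set Implicit Arguments.
Unset Strict Implicit.
Unset Printing Implicit Defensive.
Import Order.TTheory GRing.Theory Num.Theory.
Import numFieldNormedType.Exports.
Import ComplexField.Normc.

Local Open Scope classical_set_scope.
Local Open Scope ring_scope.
Local Open Scope complex_scope.

Lemma measurable_normc d (T : measurableType d) (R : realType)
    (u : T -> R[i]) :
  measurable_fun setT (fun t => complex.Re (u t)) ->
  measurable_fun setT (fun t => complex.Im (u t)) ->
  measurable_fun setT (fun t => normc (u t)).
Proof.
move=> mr mi.
have -> : (fun t => normc (u t)) =
    (@Num.sqrt R) \o (fun t => complex.Re (u t) ^+ 2 + complex.Im (u t) ^+ 2).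
  by apply/funext => t /=; case: (u t).
apply: measurableT_comp.
  exact: (continuous_measurable_fun (@sqrt_continuous R)).
by apply: measurable_funD; exact: measurable_funX.
Qed.

(* L^2(mu) with complex values: square-integrable functions T -> R[i], modulo
   equality almost everywhere. As mathcomp-analysis puts no sigma-algebra on
   R[i], measurability is stated for the real and imaginary parts. *)
Section L2.
Context d (T : measurableType d) (R : realType).
Variable mu : {measure set T -> \bar R}.

Definition l2norm (u : T -> R[i]) : \bar R :=
  Lnorm mu 2%:E (fun t => (normc (u t))%:E).

Definition l2pred : {pred T -> R[i]} := mem [set u : T -> R[i] |
  [/\ measurable_fun setT (fun t => complex.Re (u t)),
      measurable_fun setT (fun t => complex.Im (u t)) &
      (l2norm u < +oo)%E]].

Lemma l2predP (u : T -> R[i]) : reflect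
  [/\ measurable_fun setT (fun t => complex.Re (u t)),
      measurable_fun setT (fun t => complex.Im (u t)) &
      (l2norm u < +oo)%E] (u \in l2pred).
Proof. by apply: (iffP idP) => [/set_mem//|?]; exact/mem_set. Qed.

Lemma le_l2normD (u v : T -> R[i]) : u \in l2pred -> v \in l2pred ->
  (l2norm (u + v)%R <= l2norm u + l2norm v)%E.
Proof.
move=> /l2predP[ru iu _] /l2predP[rv iv _].
have mu' := measurable_normc ru iu; have mv' := measurable_normc rv iv.
apply: (@le_trans _ _
    (Lnorm mu 2%:E (fun t => (normc (u t) + normc (v t))%:E))); last first.
  apply: (@eminkowski _ _ _ mu (fun t => normc (u t)) (fun t => normc (v t)));
    by rewrite // lee_fin ler1n.
have mf (f : T -> R) : measurable_fun setT f ->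
    measurable_fun setT (fun x => (`|f x| `^ 2)%:E).
  move=> mf; apply/measurable_EFinP.
  apply: (measurableT_comp (measurable_powR _)) => //.
  exact: measurableT_comp.
have nn (z : R[i]) : 0 <= normc z by case: z => a b; exact: sqrtr_ge0.
rewrite /l2norm unlock /=; apply: gt0_ler_poweR.
- by rewrite invr_ge0.
- rewrite in_itv/= leey andbT; apply: integral_ge0 => x _.
  by rewrite lee_fin powR_ge0.
- rewrite in_itv/= leey andbT; apply: integral_ge0 => x _.
  by rewrite lee_fin powR_ge0.
apply: ge0_le_integral => //.
- apply: (mf (fun t => normc ((u + v) t))); apply: measurable_normc.
  + have -> : (fun t => complex.Re ((u + v) t)) =
        (fun t => complex.Re (u t)) \+ (fun t => complex.Re (v t)).
      by apply/funext => t; rewrite /= fctE; case: (u t); case: (v t).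
    exact: measurable_funD.
  + have -> : (fun t => complex.Im ((u + v) t)) =
        (fun t => complex.Im (u t)) \+ (fun t => complex.Im (v t)).
      by apply/funext => t; rewrite /= fctE; case: (u t); case: (v t).
    exact: measurable_funD.
- by apply: (mf (fun t => normc (u t) + normc (v t))); exact: measurable_funD.
move=> x _; rewrite lee_fin; apply: ge0_ler_powR; rewrite ?nnegrE//.
by rewrite !ger0_norm ?addr_ge0 ?nn//; exact: le_normcD.
Qed.

Lemma l2norm0 : l2norm 0 = 0%E.
Proof.
rewrite /l2norm (_ : (fun t => _) = cst 0%E).
  by rewrite Lnorm0// eqe pnatr_eq0.
by apply/funext => t; congr EFin; exact: normc0.
Qed.

Lemma normc_ge0 (z : R[i]) : 0 <= normc z.
Proof. by case: z => a b; exact: sqrtr_ge0. Qed.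

Lemma l2normE (u : T -> R[i]) :
  l2norm u = ((\int[mu]_t (normc (u t) `^ 2)%:E) `^ 2^-1)%E.
Proof.
rewrite /l2norm unlock; apply: (congr1 (fun I => poweR I 2^-1)).
apply: eq_integral => t _ /=.
by rewrite ger0_norm// normc_ge0.
Qed.

Lemma l2normZ (a : R[i]) (u : T -> R[i]) : u \in l2pred ->
  (l2norm (a *: u)%R = (normc a)%:E * l2norm u)%E.
Proof.
move=> /l2predP[ru iu _]; rewrite !l2normE.
have -> : (\int[mu]_t (normc ((a *: u) t) `^ 2)%:E =
    (normc a `^ 2)%:E * \int[mu]_t (normc (u t) `^ 2)%:E)%E.
  rewrite -ge0_integralZl//.
  - apply: eq_integral => t _; rewrite -EFinM -powRM ?normc_ge0//.
    by rewrite -normcM.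
  - apply/measurable_EFinP; apply: (measurableT_comp (measurable_powR _)) => //.
    exact: measurable_normc.
  - by move=> t _; rewrite lee_fin powR_ge0.
  - by rewrite lee_fin powR_ge0.
have : (0 <= \int[mu]_t (normc (u t) `^ 2)%:E)%E.
  by apply: integral_ge0 => t _; rewrite lee_fin powR_ge0.
move: (integral _ _ _) (normc_ge0 a) => I; move: (normc a) => k k0 I0.
rewrite poweRM ?lee_fin ?powR_ge0//; congr (_ * _)%E.
by rewrite poweR_EFin -powRrM mulfV ?pnatr_eq0// powRr1.
Qed.

Lemma l2pred_submod : submod_closed l2pred.
Proof.
have Z (a : R[i]) u : u \in l2pred -> a *: u \in l2pred.
  move=> ul; have /l2predP[ru iu fu] := ul; apply/l2predP; split.
  - rewrite (_ : (fun t => _) =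
        (fun t => complex.Re a * complex.Re (u t)) \-
        (fun t => complex.Im a * complex.Im (u t))).
      by apply: measurable_funB; exact: measurable_funM.
    apply/funext => t /=; rewrite /GRing.scale /=.
    by case: (u t) => ? ?; case: (a).
  - rewrite (_ : (fun t => _) =
        (fun t => complex.Re a * complex.Im (u t)) \+
        (fun t => complex.Im a * complex.Re (u t))).
      by apply: measurable_funD; exact: measurable_funM.
    apply/funext => t /=; rewrite /GRing.scale /=.
    by case: (u t) => ? ?; case: (a).
  - rewrite l2normZ// lte_mul_pinfty// lee_fin.
    exact: normc_ge0.
split.
  by apply/l2predP; rewrite l2norm0; split => //=; exact: measurable_cst.
move=> a u v ul vl; have al := Z a u ul.
have /l2predP[ru iu fu] := al; have /l2predP[rv iv fv] := vl.
apply/l2predP; split.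
- have -> : (fun t => complex.Re ((a *: u + v) t)) =
      (fun t => complex.Re ((a *: u) t)) \+ (fun t => complex.Re (v t)).
    by apply/funext => t; rewrite /= fctE; case: ((a *: u) t); case: (v t).
  exact: measurable_funD.
- have -> : (fun t => complex.Im ((a *: u + v) t)) =
      (fun t => complex.Im ((a *: u) t)) \+ (fun t => complex.Im (v t)).
    by apply/funext => t; rewrite /= fctE; case: ((a *: u) t); case: (v t).
  exact: measurable_funD.
- by rewrite (le_lt_trans (le_l2normD al vl))// lte_add_pinfty.
Qed.

HB.instance Definition _ := GRing.isSubmodClosed.Build R[i] (T -> R[i]) l2pred
  l2pred_submod.

Record L2fun := MkL2fun { l2val :> T -> R[i] ; _ : l2val \in l2pred }.

HB.instance Definition _ := [isSub for l2val].
HB.instance Definition _ := [Choice of L2fun by <:].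
HB.instance Definition _ := [SubChoice_isSubLmodule of L2fun by <:].

Lemma l2valD (u v : L2fun) t : l2val (u + v) t = u t + v t.
Proof. by []. Qed.

Lemma l2valB (u v : L2fun) t : l2val (u - v) t = u t - v t.
Proof. by []. Qed.

Lemma l2valZ (a : R[i]) (u : L2fun) t : l2val (a *: u) t = a * u t.
Proof. by []. Qed.

Definition l2null : {pred L2fun} :=
  mem [set u : L2fun | {ae mu, forall t, l2val u t = 0}].

Lemma l2null_zmod : zmod_closed l2null.
Proof.
split; first by apply/mem_set; exact: aeW.
move=> u v /set_mem u0 /set_mem v0; apply/mem_set.
by apply: filterS2 u0 v0 => t ut vt; rewrite l2valB ut vt subrr.
Qed.

HB.instance Definition _ := GRing.isZmodClosed.Build L2fun l2null l2null_zmod.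

Definition L2 : Type := {ideal_quot l2null}.
HB.instance Definition _ := GRing.Zmodule.on L2.
HB.instance Definition _ := ZmodQuotient.on L2.

Local Open Scope quotient_scope.

Lemma pi_L2P (u v : L2fun) :
  reflect {ae mu, forall t, u t = v t} (\pi_L2 u == \pi_L2 v).
Proof.
rewrite -Quotient.idealrBE; apply: (iffP idP) => [/set_mem|] uv.
  by apply: filterS uv => t; rewrite l2valB => /eqP; rewrite subr_eq0 => /eqP.
by apply/mem_set; apply: filterS uv => t uv; rewrite l2valB uv subrr.
Qed.

Lemma repr_pi_L2 (u : L2fun) : {ae mu, forall t, repr (\pi_L2 u) t = u t}.
Proof. by apply/pi_L2P; rewrite reprK. Qed.

Definition L2scale (a : R[i]) (u : L2) : L2 := \pi_L2 (a *: repr u).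

Lemma L2scale_pi a (u : L2fun) : L2scale a (\pi_L2 u) = \pi_L2 (a *: u).
Proof.
apply/eqP/pi_L2P; have uu := repr_pi_L2 u; apply: filterS uu => t ut.
by rewrite !l2valZ ut.
Qed.

Lemma L2scaleA a b (u : L2) : L2scale a (L2scale b u) = L2scale (a * b) u.
Proof. by elim/quotW: u => u; rewrite (L2scale_pi b) !L2scale_pi scalerA. Qed.

Lemma L2scale1 : left_id 1 L2scale.
Proof. by elim/quotW => u; rewrite L2scale_pi scale1r. Qed.

Lemma L2scaleDr : right_distributive L2scale +%R.
Proof.
move=> a; elim/quotW => u; elim/quotW => v.
by rewrite -pi_addr !L2scale_pi -pi_addr scalerDr.
Qed.

Lemma L2scaleDl (u : L2) : {morph L2scale^~ u : a b / a + b}.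
Proof. by elim/quotW: u => u a b; rewrite !L2scale_pi -pi_addr scalerDl. Qed.

HB.instance Definition _ := GRing.Zmodule_isLmodule.Build R[i] L2
  L2scaleA L2scale1 L2scaleDr L2scaleDl.

Definition L2norm (u : L2) : R[i] := (fine (l2norm (repr u)))%:C.

Lemma l2norm_ae (u v : L2fun) :
  {ae mu, forall t, u t = v t} -> l2norm u = l2norm v.
Proof.
move=> uv; rewrite !l2normE; apply: (congr1 (fun I => poweR I 2^-1)).
have mf (f : L2fun) : measurable_fun setT (fun t => (normc (f t) `^ 2)%:E).
  have /l2predP[rf if_ _] := valP f; apply/measurable_EFinP.
  by apply: (measurableT_comp (measurable_powR _)) => //; exact: measurable_normc.
apply: ae_eq_integral => //.
by apply: filterS uv => t uvt _ /=; rewrite uvt.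
Qed.

Lemma fin_l2norm (u : L2fun) : l2norm u \is a fin_num.
Proof.
have /l2predP[_ _ fu] := valP u.
by rewrite ge0_fin_numE// Lnorm_ge0.
Qed.

Lemma L2norm_pi (u : L2fun) : L2norm (\pi_L2 u) = (fine (l2norm u))%:C.
Proof. by rewrite /L2norm (l2norm_ae (repr_pi_L2 u)). Qed.

Lemma ler_L2normD (u v : L2) : L2norm (u + v) <= L2norm u + L2norm v.
Proof.
elim/quotW: u => u; elim/quotW: v => v.
rewrite -pi_addr !L2norm_pi -rmorphD/= lecR.
rewrite -fineD ?fin_l2norm// fine_le// ?fin_numD ?fin_l2norm//.
  exact: (fin_l2norm (u + v)).
exact: (le_l2normD (valP u) (valP v)).
Qed.

Lemma L2normZ (a : R[i]) (u : L2) : L2norm (a *: u) = `|a| * L2norm u.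
Proof.
elim/quotW: u => u; rewrite [_ *: _]L2scale_pi !L2norm_pi normc_def.
rewrite (l2normZ a (valP u)) fineM ?fin_l2norm// rmorphM/=.
by case: a.
Qed.

Lemma L2norm0_eq0 (u : L2) : L2norm u = 0 -> u = 0.
Proof.
elim/quotW: u => u; rewrite L2norm_pi => -[] nu0.
have -> : (0 : L2) = \pi_L2 0 by rewrite pi_zeror.
apply/eqP/pi_L2P.
have u0 : l2norm u = 0%E by rewrite -[LHS]fineK ?fin_l2norm// nu0.
have /l2predP[ru iu _] := valP u.
have := @Lnorm_eq0_eq0 _ _ _ mu (fun t => (normc (u t))%:E) 2%:E.
move=> /(_ _ _ u0); case.
- by apply/measurable_EFinP; exact: measurable_normc.
- by rewrite lte_fin.
move=> A [mA A0 sA]; exists A; split => // t /= nt; apply: sA => /=.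
by apply: contra_not nt => /(_ I) [] /eq0_normc.
Qed.

HB.instance Definition _ :=
  Lmodule_isNormed.Build R[i] L2 ler_L2normD L2normZ L2norm0_eq0.

(* Functions outside L^2 are sent to 0; it is only meant for square-integrable
   functions. *)
Definition L2class (u : T -> R[i]) : L2 :=
  if insub u is Some v then \pi_L2 v else 0.

Definition L2fun_of (u : L2) : T -> R[i] := l2val (repr u).

Definition Cintegral (D : set T) (u : T -> R[i]) : R[i] :=
  (\int[mu]_(t in D) complex.Re (u t)) +i* (\int[mu]_(t in D) complex.Im (u t)).

Definition L2dot (u v : L2) : R[i] :=
  Cintegral setT (fun t => L2fun_of u t * (L2fun_of v t)^*).

End L2.

Record bounded_operator (R : realType) (V : normedModType R[i]) :=
  BoundedOperator {
    bop_fun :> {linear V -> V};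
    bop_continuous : continuous bop_fun }.

(* Extended-real valued and stated for arbitrary maps, so that no boundedness
   proof is needed to write it; `|f u| is a nonnegative real element of R[i],
   which complex.Re reads in R. *)
Definition opnorm (R : realType) (V : normedModType R[i]) (f : V -> V) :
    \bar R :=
  ereal_sup [set (complex.Re `|f u|)%:E | u in [set u : V | `|u| <= 1]].

(* The library rings have a unit, hence the multiplication of a possibly
   nonunital C*-algebra is given here as a bare operation. *)
HB.mixin Record CompleteNormedModule_isCStar (R : realType) A
    & CompleteNormedModule R[i] A := {
  cmul : A -> A -> A;
  cstar : A -> A;
  cmulA : associative cmul;
  cmulDl : left_distributive cmul +%R;
  cmulDr : right_distributive cmul +%R;
  cmulZl : forall (k : R[i]) (a b : A), cmul (k *: a) b = k *: cmul a b;
  cmulZr : forall (k : R[i]) (a b : A), cmul a (k *: b) = k *: cmul a b;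
  cstarD : {morph cstar : a b / a + b};
  cstarZ : forall (k : R[i]) (a : A), cstar (k *: a) = k^* *: cstar a;
  cstarM : forall a b : A, cstar (cmul a b) = cmul (cstar b) (cstar a);
  cstarK : involutive cstar;
  cnormM : forall a b : A, `|cmul a b| <= `|a| * `|b|;
  cnorm_star : forall a : A, `|cmul (cstar a) a| = `|a| ^+ 2
}.

#[short(type="cStarAlgType")]
HB.structure Definition CStarAlgebra (R : realType) :=
  {A of CompleteNormedModule R[i] A & CompleteNormedModule_isCStar R A}.

Definition unital (R : realType) (A : cStarAlgType R) : Prop :=
  exists e : A, forall a : A, cmul e a = a /\ cmul a e = a.

(* Multipliers are double centralizers (L, R), that is a L(b) = R(a) b;
   linearity and boundedness of both maps are automatic in a C*-algebra. The
   algebra is embedded by c |-> (b |-> c b, a |-> a c), and the adjoint of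
   (L, R) is (R', L') where f'(a) denotes the adjoint of
   f applied to the adjoint of a. *)
Section MultiplierAlgebra.
Context (R : realType) (A : cStarAlgType R).

Record multiplier := Multiplier {
  lmult : A -> A;
  rmult : A -> A;
  lrmult : forall a b, cmul a (lmult b) = cmul (rmult a) b }.

Lemma multiplier_embed_subproof (c a b : A) :
  cmul a (cmul c b) = cmul (cmul a c) b.
Proof. exact: cmulA. Qed.

Definition multiplier_embed (c : A) : multiplier :=
  Multiplier (multiplier_embed_subproof c).

Lemma multiplier_add_subproof (m n : multiplier) (a b : A) :
  cmul a (lmult m b + lmult n b) = cmul (rmult m a + rmult n a) b.
Proof. by rewrite cmulDr cmulDl !lrmult. Qed.

Definition multiplier_add (m n : multiplier) : multiplier :=
  Multiplier (multiplier_add_subproof m n).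

Lemma multiplier_scale_subproof (k : R[i]) (m : multiplier) (a b : A) :
  cmul a (k *: lmult m b) = cmul (k *: rmult m a) b.
Proof. by rewrite cmulZr cmulZl lrmult. Qed.

Definition multiplier_scale (k : R[i]) (m : multiplier) : multiplier :=
  Multiplier (multiplier_scale_subproof k m).

Lemma multiplier_mul_subproof (m n : multiplier) (a b : A) :
  cmul a (lmult m (lmult n b)) = cmul (rmult n (rmult m a)) b.
Proof. by rewrite !lrmult. Qed.

Definition multiplier_mul (m n : multiplier) : multiplier :=
  Multiplier (multiplier_mul_subproof m n).

Lemma multiplier_star_subproof (m : multiplier) (a b : A) :
  cmul a (cstar (rmult m (cstar b))) = cmul (cstar (lmult m (cstar a))) b.
Proof.
by rewrite -[a in LHS]cstarK -[b in RHS]cstarK -!cstarM lrmult.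
Qed.

Definition multiplier_star (m : multiplier) : multiplier :=
  Multiplier (multiplier_star_subproof m).

End MultiplierAlgebra.

(* The unit space is the common range of src (the map d) and rng (the map r)
   inside G. gmul is total but only meaningful on pairs with src x = rng y.
   Continuity of src and rng follows from src x = x^-1 x and rng x = x x^-1.
   G is pointed because g_sigma_algebraType requires it. *)
HB.mixin Record isTopologicalGroupoid G & PointedTopological G := {
  src : G -> G;
  rng : G -> G;
  gmul : G -> G -> G;
  ginv : G -> G;
  src_rng : forall x, src (rng x) = rng x;
  rng_src : forall x, rng (src x) = src x;
  src_mul : forall x y, src x = rng y -> src (gmul x y) = src y;
  rng_mul : forall x y, src x = rng y -> rng (gmul x y) = rng x;
  gmulA : forall x y z, src x = rng y -> src y = rng z ->
    gmul (gmul x y) z = gmul x (gmul y z);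
  gmul_src : forall x, gmul x (src x) = x;
  gmul_rng : forall x, gmul (rng x) x = x;
  src_inv : forall x, src (ginv x) = rng x;
  rng_inv : forall x, rng (ginv x) = src x;
  gmulV : forall x, gmul x (ginv x) = rng x;
  gmulVg : forall x, gmul (ginv x) x = src x;
  gmul_continuous : {within [set p : G * G | src p.1 = rng p.2],
    continuous (fun p : G * G => gmul p.1 p.2)};
  ginv_continuous : continuous ginv
}.

#[short(type="topGroupoidType")]
HB.structure Definition TopologicalGroupoid :=
  {G of PointedTopological G & isTopologicalGroupoid G}.

Definition borel (T : ptopologicalType) := g_sigma_algebraType (@open T).

Definition sigma_compact (T : topologicalType) : Prop :=
  exists K : nat -> set T,
    (forall n, compact (K n)) /\ \bigcup_n K n = [set: T].

(* Regular in the sense finite on compact sets, outer and inner regular on all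
   Borel sets; on a sigma-compact locally compact Hausdorff space these are the
   Radon measures. *)
Definition regular_measure (R : realType) (T : ptopologicalType)
    (mu : {measure set (borel T) -> \bar R}) : Prop :=
  [/\ forall K : set T, compact K -> (mu K < +oo)%E,
      forall B : set (borel T), measurable B ->
        mu B =
        ereal_inf [set mu U | U in [set U : set T | open U /\ B `<=` U]] &
      forall B : set (borel T), measurable B ->
        mu B =
        ereal_sup [set mu K | K in [set K : set T | compact K /\ K `<=` B]]].

Section Groupoid.
Context (R : realType) (G : topGroupoidType).

Definition unit_space : set G := range (@src G).
Definition src_fiber (x : G) : set G := [set xi | src xi = x].
Definition groupoid_orbit (x : G) : set G := @rng G @` src_fiber x.

Definition Cc : set (G -> R[i]) :=
  [set f | continuous (f : G -> R[i]^o) /\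
           compact (closure [set xi | f xi != 0])].

(* lambda_x is encoded as a Borel measure on G carried by the closed set
   src_fiber x; only the indices x in unit_space G are relevant. *)
Record right_haar_system (lam : G -> {measure set (borel G) -> \bar R}) :
    Prop := RightHaarSystem {
  haar_fiber : forall x, unit_space x -> lam x (~` src_fiber x) = 0%E;
  haar_regular : forall x, unit_space x -> regular_measure (lam x);
  haar_full : forall x, unit_space x -> forall U : set G, open U ->
    U `&` src_fiber x !=set0 -> (0 < lam x U)%E;
  haar_continuous : forall f, Cc f -> {within unit_space,
    continuous (fun x => Cintegral (lam x) (src_fiber x) f : R[i]^o)};
  haar_invariant : forall (xi : G) (B : set (borel G)), measurable B ->
    lam (src xi) B =
    lam (rng xi) (src_fiber (rng xi) `&` [set eta | B (gmul eta xi)]) }.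

Record continuous_2cocycle (omega : G -> G -> R[i]) : Prop :=
    Continuous2Cocycle {
  cocycle_norm : forall xi eta, src xi = rng eta -> `|omega xi eta| = 1;
  cocycle_continuous : {within [set p : G * G | src p.1 = rng p.2],
    continuous (fun p : G * G => omega p.1 p.2 : R[i]^o)};
  cocycleE : forall xi eta zeta, src xi = rng eta -> src eta = rng zeta ->
    omega xi eta * omega (gmul xi eta) zeta =
    omega eta zeta * omega xi (gmul eta zeta);
  cocycle_unitl : forall eta, omega (rng eta) eta = 1;
  cocycle_unitr : forall xi, omega xi (src xi) = 1 }.

Variables (lam : G -> {measure set (borel G) -> \bar R}).
Variable (omega : G -> G -> R[i]).

(* The integral is restricted to the fiber, which carries the measure: outside
   of it, gmul xi (ginv eta) is not a product of composable elements. *)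
Definition twisted_conv (f g : G -> R[i]) : G -> R[i] := fun xi =>
  Cintegral (lam (src xi)) (src_fiber (src xi)) (fun eta =>
    f (gmul xi (ginv eta)) * g eta * omega (gmul xi (ginv eta)) eta).

Definition twisted_star (f : G -> R[i]) : G -> R[i] := fun xi =>
  (omega xi (ginv xi))^* * (f (ginv xi))^*.

(* An element of L^2(lambda_x) is a class of functions on G, of which only the
   values on src_fiber x matter: cutting them to 0 elsewhere makes f * u vanish
   elsewhere too, hence Borel on G. *)
Definition regular_rep (x : G) (f : G -> R[i]) (u : L2 (lam x)) : L2 (lam x) :=
  L2class (lam x)
    (twisted_conv f (patch (fun=> 0) (src_fiber x) (L2fun_of u))).

Definition reduced_norm (f : G -> R[i]) : \bar R :=
  ereal_sup [set opnorm (@regular_rep x f) | x in unit_space].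

(* A, with emb, is the completion of the *-algebra Cc for the reduced norm: this
   determines the C*-algebra A up to a unique isomorphism. The values of emb
   outside Cc are irrelevant. *)
Record reduced_completion (A : cStarAlgType R) (emb : (G -> R[i]) -> A) :
    Prop := ReducedCompletion {
  completionD : forall f g, Cc f -> Cc g -> emb (f + g) = emb f + emb g;
  completionZ : forall (k : R[i]) f, Cc f -> emb (k *: f) = k *: emb f;
  completionM : forall f g, Cc f -> Cc g ->
    emb (twisted_conv f g) = cmul (emb f) (emb g);
  completion_star : forall f, Cc f -> emb (twisted_star f) = cstar (emb f);
  completion_norm : forall f, Cc f ->
    (complex.Re `|emb f|)%:E = reduced_norm f;
  completion_dense : dense (emb @` Cc) }.

(* Pi is the norm-continuous extension of regular_rep x to the completion; it is
   unique by density. *)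
Definition regular_extension (x : G) (A : cStarAlgType R)
    (emb : (G -> R[i]) -> A) (Pi : A -> bounded_operator (L2 (lam x))) :
    Prop :=
  (forall f, Cc f -> forall u, Pi (emb f) u = regular_rep f u) /\
  (forall a, opnorm (fun u => Pi b u - Pi a u) @[b --> a] --> 0%E).

End Groupoid.

Arguments unit_space : clear implicits.

(* PiM is a *-homomorphism on the multiplier algebra that extends Pi; as the
   regular representation is nondegenerate, there is exactly one. *)
Record multiplier_extension d (T : measurableType d) (R : realType)
    (mu : {measure set T -> \bar R}) (A : cStarAlgType R)
    (Pi : A -> bounded_operator (L2 mu))
    (PiM : multiplier A -> bounded_operator (L2 mu)) : Prop :=
    MultiplierExtension {
  multiplier_extensionD : forall m n u,
    PiM (multiplier_add m n) u = PiM m u + PiM n u;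
  multiplier_extensionZ : forall k m u,
    PiM (multiplier_scale k m) u = k *: PiM m u;
  multiplier_extensionM : forall m n u,
    PiM (multiplier_mul m n) u = PiM m (PiM n u);
  multiplier_extension_star : forall m u v,
    L2dot (PiM m u) v = L2dot u (PiM (multiplier_star m) v);
  multiplier_extension_embed : forall a u,
    PiM (multiplier_embed a) u = Pi a u }.

(* Main.v *)
(* Fix x in the dense orbit M. It suffices that, for f in Cc(G), a bound
   |f * w| <= C |w| in L^2(lambda_x), valid for all w in Cc(G), passes to
   L^2(lambda_y) for every unit y: the reduced norm is then controlled by Pi_x
   alone.
   - If y is in M, right translation by an arrow g from y to x, twisted by
     omega(., g), intertwines convolution by f on the two fibers.
   - The functions y |-> |w|_y^2 and y |-> |f * w|_y^2 are continuous because
     f * w is again in Cc(G), so the set of units where the bound holds is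
     closed; it contains M.
   - Cc(G) is dense in L^2(lambda_y) by regularity, f * w_n converges pointwise
     to f * w when w_n converges to w in L^2, and Fatou's lemma extends the
     bound to all of L^2(lambda_y).
   For multipliers, PiM(m) Pi(a) = Pi(m a), so that PiM(m) determines m a for all
   a in A, hence m. *)
Require Import Defs.
From HB Require Import structures.
From mathcomp Require Import all_boot all_order all_algebra.
From mathcomp Require Import all_classical all_reals all_analysis.
From mathcomp Require Import measurable_realfun complex ring lra.

Set Implicit Arguments.
Unset Strict Implicit.
Unset Printing Implicit Defensive.
Import Order.TTheory GRing.Theory Num.Theory.
Import numFieldNormedType.Exports ComplexField.Normc.
Local Open Scope classical_set_scope.
Local Open Scope ring_scope.

(** * Topological preliminaries *)

(** Two obstacles shape the proof. A Haar system gives continuity only for the fiber integrals of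
    one fixed function of Cc(G). The integrand of a convolution varies with the base point and is
    meaningful only on pairs with a common source, so it is compared near each point with a
    compactly supported Tietze extension of its restriction to one fiber. Two elements with the same
    image are approximated by [emb f] and [emb g], and the bound is applied to [f - g], which is
    again in Cc(G). Square norms in [\bar R] replace norms throughout: they split into real and
    imaginary parts and into integrals without roots. The triangle inequality becomes |a + b|^2 <=
    (1 + r) |a|^2 + (1 + 1/r) |b|^2, and letting r tend to 0 preserves the constant of the bound. *)

Section ComplexTopology.
Context (R : realType).
Local Open Scope complex_scope.

(** Each component is bounded by the modulus, and two components smaller than e/2 give a modulus
    smaller than e. *)
Lemma cvg_complexP (T : Type) (F : set_system T) (FF : Filter F)
    (f : T -> R[i]^o) (l : R[i]^o) :
  f @ F --> l <->
  (complex.Re (f x) @[x --> F] --> complex.Re l) /\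
  (complex.Im (f x) @[x --> F] --> complex.Im l).
Proof.
split=> [/cvgrPdist_lt fl|[/cvgrPdist_lt rl /cvgrPdist_lt il]].
  have E e : 0 < e -> \forall t \near F, complex.Re `|l - f t| < e.
    move=> e0; have := fl e%:C; rewrite ltcR => /(_ e0).
    by apply: filterS => t; rewrite ltcE => /andP[].
  split; apply/cvgrPdist_lt => e e0; have := E e e0; apply: filterS => t;
    apply: le_lt_trans; rewrite normc_def /=; case: (l) (f t) => [a b] [c d] /=.
    by rewrite -sqrtr_sqr ler_wsqrtr// lerDl sqr_ge0.
  by rewrite -sqrtr_sqr ler_wsqrtr// lerDr sqr_ge0.
(* Positivity in [R[i]] forces [e] to be real, so the tolerance is [complex.Re e]. *)
apply/cvgrPdist_lt => e e0; have [e1 e2] : 0 < complex.Re e /\ complex.Im e = 0.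
  by move: e0; rewrite ltcE /= => /andP[/eqP -> ->].
have e3 : 0 < complex.Re e / 2 by rewrite divr_gt0.
have := rl _ e3; have := il _ e3; apply: filterS2 => t ti tr.
rewrite ltcE normc_def /= e2 eqxx /=.
have -> : complex.Re (l - f t) = complex.Re l - complex.Re (f t).
  by case: (l) (f t) => [? ?] [? ?].
have -> : complex.Im (l - f t) = complex.Im l - complex.Im (f t).
  by case: (l) (f t) => [? ?] [? ?].
rewrite -[ltRHS](ger0_norm (ltW e1)) -sqrtr_sqr ltr_sqrt ?exprn_gt0//.
rewrite -(real_normK (num_real (_ - complex.Re _))).
rewrite -(real_normK (num_real (_ - complex.Im _))).
have a0 := normr_ge0 (complex.Re l - complex.Re (f t)).
have b0 := normr_ge0 (complex.Im l - complex.Im (f t)).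
move: a0 b0 ti tr; move: `|_| `|_| (complex.Re e) e1 => a b c; nra.
Qed.

End ComplexTopology.

Section Topology.

Lemma continuous_within_comp (X Y Z : topologicalType) (f : X -> Y)
    (g : Y -> Z) (A : set X) (B : set Y) :
  {within A, continuous f} -> (forall x, A x -> B (f x)) ->
  {within B, continuous g} -> {within A, continuous (g \o f)}.
Proof.
move=> /subspace_continuousP cf AB /subspace_continuousP cg.
apply/subspace_continuousP => x Ax.
apply: cvg_comp (cg _ (AB _ Ax)) => U /(cf _ Ax).
rewrite !near_simpl /=; apply: filterS2 (withinT A (nbhs_filter x)).
by move=> y Ay; apply; exact: AB.
Qed.

Lemma continuous_within_pair (X Y Z : topologicalType) (f : X -> Y)
    (g : X -> Z) (A : set X) :
  {within A, continuous f} -> {within A, continuous g} ->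
  {within A, continuous (fun x => (f x, g x))}.
Proof. by move=> cf cg x; have := cvg_pair (cf x) (cg x); exact. Qed.

Lemma closed_equalizer (X Y : topologicalType) (f g : X -> Y) :
  hausdorff_space Y -> continuous f -> continuous g ->
  closed [set x | f x = g x].
Proof.
move=> hY cf cg x clx; apply: hY => U V fU gV.
have /clx[y [/= fg [fy gy]]] : nbhs x (f @^-1` U `&` g @^-1` V).
  by apply: filterI; [exact: cf|exact: cg].
by exists (f y); split => //; rewrite fg.
Qed.

Lemma within_bounded (R : realType) (X : topologicalType)
    (S L : set X) (f : X -> R) : closed S -> compact L ->
  {within S, continuous f} -> (forall x, S x -> ~ L x -> f x = 0) ->
  exists2 B : R, 0 < B & forall x, S x -> `|f x| <= B.
Proof.
move=> clS cL cf fL; have cSL : compact (S `&` L).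
  by rewrite setIC; exact: compact_closedI.
have /compact_bounded[N [_ N1]] : compact (f @` (S `&` L)).
  apply: continuous_compact => //.
  by apply: continuous_subspaceW cf; exact: subIsetl.
exists (Num.max 1 (N + 1)); first by rewrite lt_max ltr01.
have NB : N < Num.max 1 (N + 1) by rewrite lt_max ltrDl ltr01 orbT.
move=> x Sx; have [Lx|Lx] := pselect (L x); last by rewrite fL// normr0 le_max ler01.
by apply: (N1 _ NB); exists x.
Qed.

End Topology.

(** * Urysohn and Tietze with compact support, through the one-point compactification *)

Section LocallyCompact.
Context (R : realType) (X : topologicalType).
Hypothesis (hX : hausdorff_space X) (lcX : locally_compact [set: X]).

Let opc := one_point_compactification X.

Let normal_opc : normal_space opc.
Proof.
apply: compact_normal; first exact: one_point_compactification_hausdorff.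
exact: one_point_compactification_compact.
Qed.

Let opc_compact_preimage (C : set opc) :
  closed C -> ~ C None -> compact ((Some : X -> opc) @^-1` C).
Proof.
move=> cC CN; have : nbhs (None : opc) (~` C).
  by apply: open_nbhs_nbhs; split => //; exact: closed_openC.
case=> W [cW clW] WC; apply: (subclosed_compact _ cW).
  apply: preimage_closed cC => x _; exact: one_point_compactification_some_continuous.
by move=> x /= Cx; apply: contrapT => Wx; apply: (WC (Some x)) => //; left; exists x.
Qed.

Let continuous_opc_comp (f : opc -> R) :
  continuous f -> continuous (fun x => f (Some x)).
Proof.
move=> cf x; apply: (@continuous_comp _ _ _ (Some : X -> opc) f); last exact: cf.
exact: one_point_compactification_some_continuous.
Qed.

Let opc_closed_image (K : set X) : compact K -> closed ((Some : X -> opc) @` K).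
Proof.
move=> cK; apply: compact_closed.
  exact: one_point_compactification_hausdorff.
apply: continuous_compact => //; apply: continuous_subspaceT.
exact: one_point_compactification_some_continuous.
Qed.

(** A locally compact Hausdorff space need not be normal, but its one-point compactification is.
    There the complement of [U] contains the point at infinity and is closed, as is the image of
    [K]. *)
Lemma compact_urysohn (K U : set X) : compact K -> open U -> K `<=` U ->
  exists f : X -> R, [/\ continuous f, forall x, 0 <= f x <= 1,
    forall x, K x -> f x = 1, forall x, ~ U x -> f x = 0 &
    exists2 L, compact L & forall x, ~ L x -> f x = 0].
Proof.
move=> cK oU KU; pose iota := Some : X -> opc.
have disj : ~` (iota @` U) `&` (iota @` K) = set0.
  rewrite -subset0 => _ [] /[swap] -[x Kx <-]; apply; exists x => //; exact: KU.
have [f [cf f0 f1 f01]] := @urysohn_ext_itv opc R normal_opc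
  (~` (iota @` U)) (iota @` K) 0 1
  (open_closedC (one_point_compactification_open_some _ oU))
  (opc_closed_image cK) disj ltr01.
(* {f >= 1/2} is closed in the compactification and avoids the point at infinity,
   hence is compact in X. *)
pose g x := Num.max 0 (2 * f (Some x) - 1); exists g; split.
- move=> x; apply: (@continuous_max R X (fun=> 0)); first exact: cvg_cst.
  apply: (@cvgB R R^o); last exact: cvg_cst.
  apply: cvgM; first exact: cvg_cst.
  exact: continuous_opc_comp.
- move=> x; rewrite /g le_max lexx /= ge_max ler01 /=.
  have /= : range f (f (Some x)) by exists (Some x).
  by move=> /f01; rewrite /= in_itv /= => /andP[? ?]; lra.
- move=> x Kx; rewrite /g (_ : f (Some x) = 1).
    by rewrite mulr1 (_ : 2 - 1 = 1) ?max_r //; lra.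
  by apply: f1; exists (Some x) => //; exists x.
- move=> x Ux; rewrite /g (_ : f (Some x) = 0).
    by rewrite mulr0 sub0r max_l// lerN10.
  apply: f0; exists (Some x) => //= -[y Uy [yx]]; apply: Ux.
  by rewrite -yx.
- exists (iota @^-1` (f @^-1` [set r | 2^-1 <= r])).
    apply: opc_compact_preimage.
      by apply: preimage_closed => [y _|]; [exact: cf|exact: closed_ge].
    rewrite /= (_ : f None = 0); last by apply: f0; exists None => //= -[].
    by apply/negP; rewrite -ltNge invr_gt0.
  move=> x /= /negP; rewrite -ltNge => fx; rewrite /g max_l//.
  by rewrite subr_le0 -ler_pdivlMl// mulr1 ltW.
Qed.

(** Extended by 0 at infinity, [k] stays continuous on the closed set [S'] made of [S] and that
    point, because it vanishes on [S] outside the compact set [L]. Tietze's theorem then applies in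
    the compactification. *)
Lemma compact_tietze (S L : set X) (k : X -> R) :
  closed S -> compact L -> {within S, continuous k} ->
  (forall x, S x -> ~ L x -> k x = 0) ->
  exists h : X -> R, [/\ continuous h, forall x, S x -> h x = k x &
    exists2 L', compact L' & forall x, ~ L' x -> h x = 0].
Proof.
move=> clS cL ck kL; pose iota := Some : X -> opc.
pose k' (y : opc) : R := if y is Some x then k x else 0.
pose S' : set opc := [set y | if y is Some x then S x else True].
have clS' : closed S'.
  rewrite -openC openE => -[x|] //= Sx; rewrite /interior /=.
  change (nbhs x (iota @^-1` (~` S'))).
  by apply: open_nbhs_nbhs; split => //; exact: closed_openC.
have clL : closed L by exact: compact_closed.
have ck' : {within S', continuous k'}.
  apply/subspace_continuousP => -[x|] S'x.
    move/subspace_continuousP : ck => /(_ x S'x) ck U /ck; exact.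
  apply: cvg_near_cst; rewrite /within /=.
  exists L => // _ [[x Lx <-]|->] //= Sx; exact: kL.
have [B B0 kB] : exists2 B, 0 < B & forall y, S' y -> `|k' y| <= B.
  have [B B0 kB] := within_bounded clS cL ck kL.
  by exists B => // -[x|] /=; [exact: kB|rewrite normr0 ltW].
have [h [hk ch hB]] := continuous_bounded_extension normal_opc clS' B0 ck' kB.
(* The Tietze extension may fail to have compact support. Multiplying it by [f], equal to 1 on [L],
   repairs this and does not change it on [S], where [k] vanishes outside [L]. *)
have [f [cf f01 f1 _ [L' cL' f0]]] := compact_urysohn cL openT (@subsetT _ _).
exists (fun x => h (Some x) * f x); split.
- move=> x; apply: cvgM; last exact: cf.
  exact: continuous_opc_comp.
- move=> x Sx; rewrite -hk ?inE// /k'.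
  by have [/f1->|Lx] := pselect (L x); rewrite ?mulr1// kL// mul0r.
- by exists L' => // x /f0->; rewrite mulr0.
Qed.

End LocallyCompact.

(** * Square-integrable functions *)

Section SquareIntegral.
Context d (T : measurableType d) (R : realType).
Variable mu : {measure set T -> \bar R}.
Local Open Scope ereal_scope.

Definition sqint (f : T -> R) : \bar R := \int[mu]_t ((f t) ^+ 2)%:E.

Lemma sqint_ge0 f : 0 <= sqint f.
Proof. by apply: integral_ge0 => t _; rewrite lee_fin sqr_ge0. Qed.

Lemma measurable_sq (f : T -> R) : measurable_fun setT f ->
  measurable_fun setT (fun t => ((f t) ^+ 2)%:E).
Proof. by move=> mf; apply/measurable_EFinP; exact: measurable_funX. Qed.

Lemma le_sqint (f g : T -> R) : measurable_fun setT f ->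
  measurable_fun setT g -> (forall t, (`|f t| <= `|g t|)%R) ->
  sqint f <= sqint g.
Proof.
move=> mf mg fg; apply: ge0_le_integral => //.
- by move=> t _; rewrite lee_fin sqr_ge0.
- exact: measurable_sq.
- exact: measurable_sq.
- move=> t _; rewrite lee_fin -(real_normK (num_real (f t))).
  by rewrite -(real_normK (num_real (g t))) lerXn2r ?nnegrE.
Qed.

(** Expanding r^-1 (r f - g)^2 >= 0 gives 2 f g <= r f^2 + r^-1 g^2. The weight is left free so that
    the factor of [sqint f] can be brought arbitrarily close to 1. *)
Lemma sqintD_weighted (r : R) (f g : T -> R) : (0 < r)%R ->
  measurable_fun setT f -> measurable_fun setT g ->
  sqint (f \+ g)%R <= (1 + r)%:E * sqint f + (1 + r^-1)%:E * sqint g.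
Proof.
move=> r0 mf mg.
have r1 : (0 <= 1 + r)%R by rewrite addr_ge0// ltW.
have r2 : (0 <= 1 + r^-1)%R by rewrite addr_ge0// invr_ge0 ltW.
have sq0 (h : T -> R) t : 0 <= ((h t) ^+ 2)%:E by rewrite lee_fin sqr_ge0.
rewrite /sqint -!ge0_integralZl_EFin//; [|exact: measurable_sq..].
rewrite -ge0_integralD//; last 4 first.
- by move=> t _; rewrite mule_ge0// lee_fin.
- by apply: measurable_funeM; exact: measurable_sq.
- by move=> t _; rewrite mule_ge0// lee_fin.
- by apply: measurable_funeM; exact: measurable_sq.
apply: ge0_le_integral => //.
- by apply: measurable_sq; exact: measurable_funD.
- by apply: emeasurable_funD; apply: measurable_funeM; exact: measurable_sq.
- move=> t _; rewrite -!EFinM -EFinD lee_fin /=.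
  have : (0 <= r^-1 * (r * f t - g t) ^+ 2)%R.
    by rewrite mulr_ge0 ?sqr_ge0// invr_ge0 ltW.
  have -> : (r^-1 * (r * f t - g t) ^+ 2 =
      r * (f t) ^+ 2 - 2 * f t * g t + r^-1 * (g t) ^+ 2)%R.
    by field; rewrite gt_eqF.
  by rewrite sqrrD mulrDl mul1r; lra.
Qed.

Lemma sqintD (f g : T -> R) : measurable_fun setT f -> measurable_fun setT g ->
  sqint (f \+ g)%R <= 2%:E * (sqint f + sqint g).
Proof.
move=> mf mg; rewrite ge0_muleDr ?sqint_ge0//.
by have := sqintD_weighted ltr01 mf mg; rewrite invr1.
Qed.

Lemma sqintZ (c : R) (f : T -> R) : measurable_fun setT f ->
  sqint (fun t => c * f t)%R = (c ^+ 2)%:E * sqint f.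
Proof.
move=> mf; rewrite /sqint -ge0_integralZl_EFin ?sqr_ge0//.
- by apply: eq_integral => t _; rewrite exprMn EFinM.
- by move=> t _; rewrite lee_fin sqr_ge0.
- exact: measurable_sq.
Qed.

Variable C : set (T -> R).
Hypothesis Cm : forall g, C g -> measurable_fun setT g.
Hypothesis C0 : C (fun=> 0%R).
Hypothesis CD : forall f g, C f -> C g -> C (f \+ g)%R.
Hypothesis CZ : forall (c : R) f, C f -> C (fun t => c * f t)%R.

(** Membership in the closure of [C] for the L^2 seminorm. The class [C] stands for the real
    functions of Cc(G) but stays abstract: the passage from indicators to all square-integrable
    functions is pure measure theory. *)
Definition sq_approx (f : T -> R) : Prop := measurable_fun setT f /\
  forall e : R, (0 < e)%R -> exists2 g, C g & sqint (f \- g)%R <= e%:E.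

Lemma sq_approxD f g : sq_approx f -> sq_approx g -> sq_approx (f \+ g)%R.
Proof.
move=> [mf af] [mg ag]; split; first exact: measurable_funD.
move=> e e0; have e4 : (0 < e / 4)%R by rewrite divr_gt0.
have [f' Cf' ff'] := af _ e4; have [g' Cg' gg'] := ag _ e4.
exists (f' \+ g')%R; first exact: CD.
have -> : ((f \+ g) \- (f' \+ g') = (f \- f') \+ (g \- g'))%R.
  by apply/funext => t /=; ring.
have mf' := Cm Cf'; have mg' := Cm Cg'.
apply: (le_trans (sqintD (measurable_funB mf mf') (measurable_funB mg mg'))).
apply: (@le_trans _ _ (2%:E * ((e / 4)%:E + (e / 4)%:E))).
  by rewrite lee_wpmul2l ?lee_fin ?ler0n// leeD.
by rewrite -EFinD -EFinM lee_fin; lra.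
Qed.

Lemma sq_approxZ (c : R) f : sq_approx f -> sq_approx (fun t => c * f t)%R.
Proof.
move=> [mf af]; split; first exact: measurable_funM.
move=> e e0; have c1 : (0 < c ^+ 2 + 1)%R by rewrite ltr_wpDl// sqr_ge0.
have [f' Cf' ff'] := af _ (divr_gt0 e0 c1).
exists (fun t => c * f' t)%R; first exact: CZ.
have -> : ((fun t => c * f t) \- (fun t => c * f' t) =
   (fun t => c * (f \- f') t))%R by apply/funext => t /=; ring.
rewrite sqintZ; last exact: measurable_funB (Cm Cf').
apply: (@le_trans _ _ ((c ^+ 2)%:E * (e / (c ^+ 2 + 1))%:E)).
  by rewrite lee_wpmul2l// lee_fin sqr_ge0.
rewrite -EFinM lee_fin mulrA ler_pdivrMr//.
by rewrite mulrC ler_wpM2l ?(ltW e0)// lerDl.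
Qed.

Lemma sq_approx0 : sq_approx (fun=> 0%R).
Proof.
split; first exact: measurable_cst.
move=> e e0; exists (fun=> 0%R) => //.
rewrite /sqint integral0_eq ?lee_fin ?(ltW e0)// => t _ /=.
by rewrite subrr expr0n.
Qed.

Lemma sq_approx_sum (I : Type) (r : seq I) (F : I -> T -> R) :
  (forall i, sq_approx (F i)) -> sq_approx (fun t => \sum_(i <- r) F i t)%R.
Proof.
move=> aF; elim: r => [|i r IH].
  by under eq_fun do rewrite big_nil; exact: sq_approx0.
by under eq_fun do rewrite big_cons; exact: sq_approxD.
Qed.

Lemma sq_approx_cvg (f : T -> R) : measurable_fun setT f ->
  (forall e : R, (0 < e)%R ->
    exists2 g, sq_approx g & sqint (f \- g)%R <= e%:E) -> sq_approx f.
Proof.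
move=> mf af; split => // e e0; have e4 : (0 < e / 4)%R by rewrite divr_gt0.
have [g [mg ag] fg] := af _ e4; have [g' Cg' gg'] := ag _ e4.
exists g' => //; have -> : (f \- g' = (f \- g) \+ (g \- g'))%R.
  by apply/funext => t /=; ring.
have mg' := Cm Cg'.
apply: (le_trans (sqintD (measurable_funB mf mg) (measurable_funB mg mg'))).
apply: (@le_trans _ _ (2%:E * ((e / 4)%:E + (e / 4)%:E))).
  by rewrite lee_wpmul2l ?lee_fin ?ler0n// leeD.
by rewrite -EFinD -EFinM lee_fin; lra.
Qed.

Hypothesis C_indic : forall B : set T, measurable B -> mu B < +oo ->
  forall e : R, (0 < e)%R -> exists2 g, C g & sqint (\1_B \- g)%R <= e%:E.

Import HBNNSimple.

Lemma sq_approx_nnsfun (s : {nnsfun T >-> R}) : sqint s < +oo -> sq_approx s.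
Proof.
move=> soo; have -> : (s : T -> R) =
    (fun t => \sum_(y <- finmap.enum_fset (fset_set (range s))) y * \1_(s @^-1` [set y]) t)%R.
  by apply/funext => t; rewrite {1}(fimfunE s t) fsbig_finite.
apply: sq_approx_sum => y; have [->|y0] := eqVneq y 0%R.
  by under eq_fun do rewrite mul0r; exact: sq_approx0.
have mB : measurable (s @^-1` [set y]) by exact: measurable_funPTI.
apply: sq_approxZ; split; first exact: measurable_indic.
apply: C_indic => //; have y2 : (0 < y ^+ 2)%R by rewrite exprn_even_gt0.
(* Chebyshev's inequality: a level set of a nonzero value has finite measure, as [C_indic]
   requires. *)
have : (y ^+ 2)%:E * mu (s @^-1` [set y]) <= sqint s.
  rewrite -[X in mu X]setIT -(integral_indic mu measurableT mB).
  rewrite -ge0_integralZl_EFin ?sqr_ge0//; last first.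
    by apply/measurable_EFinP; exact: measurable_indic.
  apply: ge0_le_integral => //.
  - by move=> t _; rewrite -EFinM lee_fin mulr_ge0// sqr_ge0.
  - by apply/measurable_EFinP; apply: measurable_funM.
  - by apply: measurable_sq; exact: measurable_funP.
  move=> t _; rewrite -EFinM lee_fin indicE.
  have [/set_mem /= ->|_] := boolP (t \in _); first by rewrite mulr1.
  by rewrite mulr0 sqr_ge0.
move=> /le_lt_trans /(_ soo); have [->|] := eqVneq (mu (s @^-1` [set y])) +oo.
  by rewrite gt0_muley ?lte_fin// ltxx.
by rewrite -ltey.
Qed.

(** The simple functions [g n] increase to [f], so (f - g n)^2 is dominated by f^2 and its integral
    tends to 0 by dominated convergence. *)
Lemma sq_approx_ge0 (f : T -> R) : measurable_fun setT f -> (forall t, (0 <= f t)%R) ->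
  sqint f < +oo -> sq_approx f.
Proof.
move=> mf f0 foo; apply: sq_approx_cvg => // e e0.
have mf' : measurable_fun setT (EFin \o f) by exact/measurable_EFinP.
pose g := nnsfun_approx measurableT mf'.
have gf t n : (g n t <= f t)%R.
  rewrite -lee_fin nnsfun_approxE.
  by apply: (@le_approx _ T R setT (EFin \o f)) => // x _; rewrite lee_fin.
have gcvg t : g n t @[n --> \oo] --> f t.
  have : (EFin \o (g ^~ t)) n @[n --> \oo] --> (f t)%:E.
    by apply: (cvg_nnsfun_approx measurableT mf') => // x _; rewrite lee_fin.
  by move=> /fine_cvgP[_].
have mg n : measurable_fun setT (g n) by exact: measurable_funP.
have hcv : {ae mu, forall t, setT t ->
    ((f t - g n t) ^+ 2)%:E @[n --> \oo] --> cst 0 t}.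
  apply: aeW => t _; apply: cvg_EFin; first exact: nearW.
  have : (f t - g n t)%R @[n --> \oo] --> (f t - f t)%R.
    by apply: cvgB; [exact: cvg_cst|exact: gcvg].
  rewrite subrr => h; have := cvgM h h; rewrite mulr0 => h2; exact: h2.
have hdom : {ae mu, forall t n, setT t ->
    `|((f t - g n t) ^+ 2)%:E| <= ((f t) ^+ 2)%:E}.
  apply: aeW => t n _; rewrite gee0_abs ?lee_fin ?sqr_ge0//.
  have g0 : (0 <= g n t)%R by [].
  by rewrite lerXn2r ?nnegrE ?subr_ge0 ?gf// lerBlDr lerDl.
have hint : mu.-integrable setT (fun t => ((f t) ^+ 2)%:E).
  apply/integrableP; split; first exact: measurable_sq.
  by under eq_integral do rewrite gee0_abs ?lee_fin ?sqr_ge0//.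
have [_ _] := @dominated_convergence _ T R mu setT measurableT
  (fun n t => ((f t - g n t) ^+ 2)%:E) (cst 0) (fun t => ((f t) ^+ 2)%:E)
  (fun n => measurable_sq (measurable_funB mf (mg n))) (measurable_cst _)
  hcv hint hdom.
rewrite integral0 => cv0.
have : nbhs (0 : \bar R) [set y | y < e%:E].
  by apply: open_nbhs_nbhs; split; [exact: open_ereal_lt_ereal|rewrite /= lte_fin].
move=> /cv0 [N _ /(_ N (leqnn N)) /= gN].
exists (g N); last exact: ltW.
apply: sq_approx_nnsfun; apply: le_lt_trans foo; apply: le_sqint => // t.
by rewrite !ger0_norm.
Qed.

Lemma sq_approx_measurable (f : T -> R) : measurable_fun setT f -> sqint f < +oo ->
  sq_approx f.
Proof.
move=> mf foo; rewrite -(funrposBneg f).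
have mp := measurable_funrpos mf; have mn := measurable_funrneg mf.
have -> : (f^\+ - f^\- = f^\+ \+ (fun t => -1 * f^\- t))%R.
  by apply/funext => t /=; rewrite mulN1r.
apply: sq_approxD; last apply: sq_approxZ; apply: sq_approx_ge0 => //.
- apply: le_lt_trans foo; apply: le_sqint => // t.
  rewrite /funrpos ger0_norm ?le_max ?lexx ?orbT//.
  by rewrite ge_max normr_ge0 ler_norm.
- apply: le_lt_trans foo; apply: le_sqint => // t.
  rewrite /funrneg ger0_norm ?le_max ?lexx ?orbT//.
  by rewrite ge_max normr_ge0 -normrN ler_norm.
Qed.

End SquareIntegral.

Section SquareIntegrableProduct.
Context d (T : measurableType d) (R : realType).
Variable mu : {measure set T -> \bar R}.
Variables (D : set T) (mD : measurable D).
Variables (a b : T -> R) (A r : R).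
Hypotheses (ma : measurable_fun D a) (mb : measurable_fun D b) (r0 : 0 < r).
Hypothesis aA : (\int[mu]_(t in D) ((a t) ^+ 2)%:E <= A%:E)%E.
Hypothesis br : (\int[mu]_(t in D) ((b t) ^+ 2)%:E <= (r ^+ 2)%:E)%E.

(* 2 |a b| <= r a^2 + b^2 / r *)
Let integral_normM : (\int[mu]_(t in D) `|a t * b t|%:E <= (r * (A + 1) / 2)%:E)%E.
Proof.
have sq0 (h : T -> R) t : (0 <= ((h t) ^+ 2)%:E)%E by rewrite lee_fin sqr_ge0.
have msq (h : T -> R) : measurable_fun D h ->
    measurable_fun D (fun t => ((h t) ^+ 2)%:E).
  by move=> mh; apply/measurable_EFinP; exact: measurable_funX.
have c1 : 0 <= r / 2 by rewrite divr_ge0 ?ltW.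
have c2 : 0 <= (2 * r)^-1 by rewrite invr_ge0 mulr_ge0 ?ltW.
apply: (@le_trans _ _ (\int[mu]_(t in D)
    ((r / 2)%:E * ((a t) ^+ 2)%:E + ((2 * r)^-1)%:E * ((b t) ^+ 2)%:E))%E).
  apply: ge0_le_integral => //.
  - apply/measurable_EFinP; apply: measurableT_comp => //.
    exact: measurable_funM.
  - by apply: emeasurable_funD; apply: measurable_funeM; exact: msq.
  move=> t _; rewrite -!EFinM -EFinD lee_fin normrM.
  rewrite -(real_normK (num_real (a t))) -(real_normK (num_real (b t))).
  move: `|a t| `|b t| => p q.
  have : 0 <= (2 * r)^-1 * (r * p - q) ^+ 2 by rewrite mulr_ge0 ?sqr_ge0.
  have -> : (2 * r)^-1 * (r * p - q) ^+ 2 =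
      r / 2 * p ^+ 2 - p * q + (2 * r)^-1 * q ^+ 2.
    by field; rewrite gt_eqF.
  lra.
rewrite ge0_integralD//; last 4 first.
- by move=> t _; rewrite mule_ge0// lee_fin.
- by apply: measurable_funeM; exact: msq.
- by move=> t _; rewrite mule_ge0// lee_fin.
- by apply: measurable_funeM; exact: msq.
rewrite !ge0_integralZl_EFin//; [|exact: msq..].
apply: (@le_trans _ _ ((r / 2)%:E * A%:E + ((2 * r)^-1)%:E * (r ^+ 2)%:E)%E).
  by apply: leeD; apply: lee_wpmul2l; rewrite ?lee_fin.
rewrite -!EFinM -EFinD lee_fin le_eqVlt; apply/orP; left; apply/eqP.
by field; rewrite gt_eqF.
Qed.

Lemma integrable_sqM : mu.-integrable D (EFin \o (fun t => a t * b t)).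
Proof.
apply/integrableP; split.
  by apply/measurable_EFinP; exact: measurable_funM.
by apply: le_lt_trans integral_normM _; rewrite ltry.
Qed.

(** A substitute for the Cauchy-Schwarz inequality. The constant is not sharp, but it is linear in
    [r] with [A] fixed, which is enough to deduce pointwise convergence from L^2 convergence. *)
Lemma Rintegral_sqM_le : `|\int[mu]_(t in D) (a t * b t)| <= r * (A + 1) / 2.
Proof.
apply: (le_trans (le_normr_Rintegral mD integrable_sqM)).
rewrite -lee_fin /Rintegral fineK//.
rewrite ge0_fin_numE; last by apply: integral_ge0 => t _; rewrite lee_fin.
by apply: le_lt_trans integral_normM _; rewrite ltry.
Qed.

End SquareIntegrableProduct.

(** * The square of the complex L^2 norm *)

Section L2Square.
Context d (T : measurableType d) (R : realType).
Variable mu : {measure set T -> \bar R}.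
Local Open Scope ereal_scope.
Local Open Scope complex_scope.

Definition l2sq (u : T -> R[i]) : \bar R :=
  sqint mu (fun t => complex.Re (u t)) + sqint mu (fun t => complex.Im (u t)).

Definition cmeasurable (u : T -> R[i]) : Prop :=
  measurable_fun setT (fun t => complex.Re (u t)) /\
  measurable_fun setT (fun t => complex.Im (u t)).

Lemma l2sq_ge0 u : 0 <= l2sq u.
Proof. by rewrite adde_ge0// sqint_ge0. Qed.

Lemma normc_sqE (z : R[i]) :
  (normc z ^+ 2 = complex.Re z ^+ 2 + complex.Im z ^+ 2)%R.
Proof. by case: z => a b /=; rewrite sqr_sqrtr// addr_ge0// sqr_ge0. Qed.

Lemma integral_sqr_normc u : cmeasurable u ->
  \int[mu]_t (normc (u t) ^+ 2)%:E = l2sq u.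
Proof.
move=> [mr mi]; rewrite /l2sq /sqint -ge0_integralD//.
- by apply: eq_integral => t _; rewrite normc_sqE EFinD.
- by move=> t _; rewrite lee_fin sqr_ge0.
- exact: measurable_sq.
- by move=> t _; rewrite lee_fin sqr_ge0.
- exact: measurable_sq.
Qed.

Lemma l2norm_l2sq u : cmeasurable u -> l2norm mu u = l2sq u `^ 2^-1.
Proof.
move=> mu'; rewrite l2normE -integral_sqr_normc//; congr (_ `^ _).
by apply: eq_integral => t _; rewrite powR_mulrn// normc_ge0.
Qed.

Lemma l2predE u : (u \in l2pred mu) <-> cmeasurable u /\ l2sq u < +oo.
Proof.
split=> [/l2predP[mr mi uoo]|[mu' uoo]].
  split => //; move: uoo; rewrite l2norm_l2sq// => uoo.
  by move: uoo; apply: contraLR; rewrite -!leNgt !leye_eq => /eqP ->;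
    rewrite poweRyr// invr_eq0.
by apply/l2predP; split; [exact: mu'.1|exact: mu'.2|rewrite l2norm_l2sq// poweR_lty].
Qed.

(** Square root and square are both monotone on the nonnegative extended reals. The equality between
    booleans allows rewriting in either direction: norms are what [opnorm] sees, squares are what
    the estimates handle. *)
Lemma le_l2norm (C : R) u v : (0 <= C)%R -> cmeasurable u -> cmeasurable v ->
  (l2norm mu u <= C%:E * l2norm mu v) = (l2sq u <= (C ^+ 2)%:E * l2sq v).
Proof.
move=> C0 mu' mv; rewrite !l2norm_l2sq//.
have -> : C%:E * l2sq v `^ 2^-1 = ((C ^+ 2)%:E * l2sq v) `^ 2^-1.
  rewrite poweRM ?lee_fin ?sqr_ge0 ?l2sq_ge0// poweR_EFin -powR_mulrn//.
  by rewrite -powRrM divff// powRr1.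
have E0 : 0 <= (C ^+ 2)%:E * l2sq v by rewrite mule_ge0 ?lee_fin ?sqr_ge0 ?l2sq_ge0.
apply/idP/idP => h; last first.
  by apply: gt0_ler_poweR; rewrite ?invr_ge0// in_itv/= leey ?l2sq_ge0 ?E0.
have {h} : (l2sq u `^ 2^-1) `^ 2 <= (((C ^+ 2)%:E * l2sq v) `^ 2^-1) `^ 2.
  by apply: gt0_ler_poweR => //; rewrite in_itv/= leey poweR_ge0.
by rewrite -!poweRrM !mulVf// !poweRe1// l2sq_ge0.
Qed.

Lemma cmeasurableB u v : cmeasurable u -> cmeasurable v ->
  cmeasurable (u \- v)%R.
Proof.
move=> [mru miu] [mrv miv]; split.
  rewrite (_ : (fun t => _) = (fun t => complex.Re (u t))%R \-
    (fun t => complex.Re (v t)))%R; first exact: measurable_funB.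
  by apply/funext => t /=; case: (u t) (v t) => [? ?] [? ?].
rewrite (_ : (fun t => _) = (fun t => complex.Im (u t))%R \-
  (fun t => complex.Im (v t)))%R; first exact: measurable_funB.
by apply/funext => t /=; case: (u t) (v t) => [? ?] [? ?].
Qed.

Lemma l2sqD_weighted (r : R) u v : (0 < r)%R -> cmeasurable u ->
  cmeasurable v ->
  l2sq (u \+ v)%R <= (1 + r)%:E * l2sq u + (1 + r^-1)%:E * l2sq v.
Proof.
move=> r0 [mru miu] [mrv miv]; rewrite /l2sq.
have -> : (fun t => complex.Re ((u \+ v)%R t)) =
    ((fun t => complex.Re (u t)) \+ (fun t => complex.Re (v t)))%R.
  by apply/funext => t /=; case: (u t) (v t) => [? ?] [? ?].
have -> : (fun t => complex.Im ((u \+ v)%R t)) =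
    ((fun t => complex.Im (u t)) \+ (fun t => complex.Im (v t)))%R.
  by apply/funext => t /=; case: (u t) (v t) => [? ?] [? ?].
rewrite 2!(ge0_muleDr _ (sqint_ge0 mu _) (sqint_ge0 mu _)) [leRHS]addeACA.
by apply: leeD; exact: sqintD_weighted.
Qed.

End L2Square.

(** * Continuous functions and regular Borel measures *)

Section Borel.
Context (R : realType) (X : ptopologicalType).

Lemma open_borel (U : set X) : open U -> measurable (U : set (borel X)).
Proof. exact: sub_sigma_algebra. Qed.

Lemma closed_borel (U : set X) : closed U -> measurable (U : set (borel X)).
Proof.
move=> cU; rewrite -[U]setCK; apply: measurableC.
by apply: open_borel; exact: closed_openC.
Qed.

Lemma within_continuous_borel (S : set X) (f : X -> R) : closed S ->
  {within S, continuous f} -> measurable_fun (S : set (borel X)) f.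
Proof.
move=> cS /continuousP cf; apply: (measurability _ (RGenOpens.measurableE R)).
move=> _ [_ [a [b ->] <-]].
have /open_subspaceP[V oV VS] : open (f @^-1` `]a, b[ : set (subspace S)).
  by apply: cf; exact: interval_open.
rewrite setIC -VS; apply: measurableI; first exact: open_borel.
exact: closed_borel.
Qed.

Lemma continuous_borel (f : X -> R) : continuous f ->
  measurable_fun (setT : set (borel X)) f.
Proof.
move=> cf; apply: within_continuous_borel; first exact: closedT.
exact: continuous_subspaceT.
Qed.

Definition vanishing_off (S : set X) (f : X -> R) : Prop :=
  forall x, ~ S x -> f x = 0.

Definition ccfun : set (X -> R) :=
  [set f | continuous f /\ exists2 L, compact L & vanishing_off L f].

Lemma ccfun0 : ccfun (fun=> 0).
Proof.
split; first by move=> x; exact: cvg_cst.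
by exists set0; [exact: compact0|].
Qed.

Lemma ccfunD f g : ccfun f -> ccfun g -> ccfun (f \+ g).
Proof.
move=> [cf [K cK fK]] [cg [L cL gL]]; split.
  by move=> x; apply: cvgD; [exact: cf|exact: cg].
exists (K `|` L); first exact: compactU.
by move=> x /not_orP[Kx Lx]; rewrite /= fK// gL// addr0.
Qed.

Lemma ccfunM (f g : X -> R) : continuous f -> ccfun g -> ccfun (fun x => f x * g x).
Proof.
move=> cf [cg [L cL gL]]; split.
  by move=> x; apply: cvgM; [exact: cf|exact: cg].
by exists L => // x Lx; rewrite gL// mulr0.
Qed.

Lemma ccfunZ (c : R) f : ccfun f -> ccfun (fun x => c * f x).
Proof. by apply: ccfunM => x; exact: cvg_cst. Qed.

Section Regular.
Hypothesis (hX : hausdorff_space X) (lcX : locally_compact [set: X]).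
Variable mu : {measure set (borel X) -> \bar R}.
Hypothesis mu_regular : regular_measure mu.

Lemma compact_borel (K : set X) : compact K -> measurable (K : set (borel X)).
Proof. by move=> cK; apply: closed_borel; exact: compact_closed. Qed.

(** On [S] the function is dominated by a multiple of the indicator of [L], whose measure is finite
    by regularity. Continuity is asked on [S] only, since convolution kernels make sense only on a
    fiber. *)
Lemma integrable_compact_support (S L : set X) (f : X -> R) : closed S ->
  compact L -> {within S, continuous f} ->
  (forall x, S x -> ~ L x -> f x = 0) ->
  mu.-integrable (S : set (borel X)) (EFin \o f).
Proof.
move=> clS cL cf fL; have [B B0 fB] := within_bounded clS cL cf fL.
have mL := compact_borel cL; have mS := closed_borel clS.
have [mu_cpt _ _] := mu_regular.
apply: (@le_integrable _ _ _ mu S mS _ (EFin \o (fun x => B * \1_L x))).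
- by apply/measurable_EFinP; exact: within_continuous_borel.
- move=> x Sx; rewrite lee_fin [leRHS]ger0_norm ?mulr_ge0 ?(ltW B0)//.
  rewrite indicE; have [_|/negP Lx] := boolP (x \in L); first by rewrite mulr1 fB.
  by rewrite mulr0 fL ?normr0// => Lx'; apply: Lx; rewrite inE.
apply/integrableP; split.
  apply/measurable_EFinP; apply: measurable_funTS.
  by apply: measurable_funM => //; exact: measurable_indic.
rewrite (eq_integral (fun x : borel X => B%:E * (\1_L x)%:E)%E); last first.
  by move=> x _; rewrite -EFinM /= ger0_norm// mulr_ge0 ?(ltW B0).
rewrite ge0_integralZl_EFin ?(ltW B0)//; last first.
  by apply/measurable_EFinP; apply: measurable_funTS; exact: measurable_indic.
rewrite integral_indic// lte_mul_pinfty ?lee_fin ?(ltW B0)//.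
apply: le_lt_trans (mu_cpt _ cL); apply: le_measure; rewrite ?inE//.
exact: measurableI.
Qed.

(** Regularity places [B] between a compact [K] and an open [U], each within e/2 of it in measure. A
    Urysohn function for [K] and [U] differs from the indicator of [B] only on [U] minus [K], and by
    at most 1. *)
Lemma ccfun_approx_indic (B : set (borel X)) : measurable B ->
  (mu B < +oo)%E -> forall e : R, 0 < e ->
  exists2 g, ccfun g & (sqint mu ((\1_B : borel X -> R) \- g)%R <= e%:E)%E.
Proof.
move=> mB Boo e e0; have e2 : 0 < e / 2 by rewrite divr_gt0.
have Bfin : mu B \is a fin_num by rewrite ge0_fin_numE.
have [mu_cpt mu_out mu_inn] := mu_regular.
have [U [oU BU] UB] : exists2 U : set X, open U /\ B `<=` U &
    (mu U < mu B + (e / 2)%:E)%E.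
  have := mu_out B mB => muB; move: (Bfin); rewrite muB => fin.
  have [_ [U [oU BU] <-] lt] := lb_ereal_inf_adherent e2 fin.
  by exists U => //; rewrite muB.
have [K [cK KB] BK] : exists2 K : set X, compact K /\ K `<=` B &
    (mu B - (e / 2)%:E < mu K)%E.
  have := mu_inn B mB => muB; move: (Bfin); rewrite muB => fin.
  have [_ [K [cK KB] <-] lt] := ub_ereal_sup_adherent e2 fin.
  by exists K => //; rewrite muB.
have [g [cg g01 g1 g0 [L cL gL]]] :=
  compact_urysohn R hX lcX cK oU (subset_trans KB BU).
exists g; first by split => //; exists L.
have mK := compact_borel cK; have mU := open_borel oU.
have mg := continuous_borel cg.
have mUK : measurable (U `\` K : set (borel X)) by exact: measurableD.
have UKB : (mu U - mu K <= e%:E)%E.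
  have Kfin : mu K \is a fin_num by rewrite ge0_fin_numE// mu_cpt.
  have Ufin : mu U \is a fin_num.
    by rewrite ge0_fin_numE// (lt_trans UB)// lte_add_pinfty// ltry.
  move: UB BK; rewrite -(fineK Kfin) -(fineK Ufin) -(fineK Bfin).
  rewrite -!EFinB -!EFinD !lte_fin lee_fin; lra.
have muUK : mu (U `\` K) = (mu U - mu K)%E.
  rewrite measureD//; last first.
    by rewrite (lt_trans UB)// lte_add_pinfty// ltry.
  by have /setIidPr -> : K `<=` U by exact: subset_trans KB BU.
apply: (@le_trans _ _ (mu (U `\` K))); last by rewrite muUK.
rewrite -[X in (_ <= mu X)%E]setIT -(integral_indic _ measurableT mUK).
apply: ge0_le_integral => //.
- by move=> x _; rewrite lee_fin sqr_ge0.
- apply: measurable_sq; apply: measurable_funB => //; exact: measurable_indic.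
- by apply/measurable_EFinP; exact: measurable_indic.
move=> x _; rewrite lee_fin /=; have [Kx|Kx] := pselect (K x).
  have -> : \1_B x = 1 :> R by rewrite indicE mem_set//; exact: KB.
  by rewrite g1// subrr expr0n.
have [Ux|Ux] := pselect (U x); last first.
  have -> : \1_B x = 0 :> R by rewrite indicE memNset// => /BU.
  by rewrite g0// subrr expr0n.
have -> : \1_(U `\` K) x = 1 :> R by rewrite indicE mem_set.
have /andP[gx0 gx1] := g01 x.
have : 0 <= (\1_B x : R) <= 1.
  by rewrite indicE; case: (_ \in _); rewrite /= ?ler01 ?lexx.
by move=> /andP[]; move: (\1_B x : R) => b; nra.
Qed.

Lemma cc_dense_sqint (f : borel X -> R) : measurable_fun setT f ->
  (sqint mu f < +oo)%E -> forall e : R, 0 < e ->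
  exists2 g, ccfun g & (sqint mu (f \- g)%R <= e%:E)%E.
Proof.
move=> mf foo.
have := @sq_approx_measurable _ _ _ mu ccfun _ ccfun0 ccfunD ccfunZ
  ccfun_approx_indic f mf foo.
move=> [|_]; last by [].
by move=> g [cg _]; exact: continuous_borel.
Qed.

End Regular.
End Borel.

(** * Convolution of compactly supported functions *)

Section GroupoidTopology.
Context (R : realType) (G : topGroupoidType).

Definition composable : set (G * G) := [set p | src p.1 = rng p.2].
Definition same_source : set (G * G) := [set p | src p.1 = src p.2].

Lemma rng_continuous : continuous (@rng G).
Proof.
apply/continuous_subspace_setT.
have -> : @rng G = (fun p : G * G => gmul p.1 p.2) \o (fun x => (x, ginv x)).
  by apply/funext => x; rewrite /= gmulV.
apply: (@continuous_within_comp _ _ _ _ _ _ composable); last exact: gmul_continuous.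
  apply: continuous_within_pair; apply: continuous_subspaceT => x.
    exact: cvg_id.
  exact: ginv_continuous.
by move=> x _; rewrite /composable /= rng_inv.
Qed.

Lemma src_continuous : continuous (@src G).
Proof.
have -> : @src G = @rng G \o @ginv G.
  by apply/funext => x; rewrite /= rng_inv.
move=> x; apply: continuous_comp; first exact: ginv_continuous.
exact: rng_continuous.
Qed.

Lemma src_src (x : G) : src (src x) = src x.
Proof. by rewrite -[src x]rng_src src_rng. Qed.

Lemma unit_space_src (x : G) : unit_space G (src x).
Proof. by exists x. Qed.

Lemma unit_space_rng (x : G) : unit_space G (rng x).
Proof. by exists (rng x) => //; rewrite src_rng. Qed.

Lemma gmulKV (x y : G) : src x = src y -> gmul (gmul x (ginv y)) y = x.
Proof.
by move=> xy; rewrite gmulA ?rng_inv ?src_inv// gmulVg -xy gmul_src.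
Qed.

Lemma src_mulV (x y : G) : src x = src y -> src (gmul x (ginv y)) = rng y.
Proof. by move=> xy; rewrite src_mul ?src_inv ?rng_inv. Qed.

Hypothesis hG : hausdorff_space G.

Lemma composable_closed : closed composable.
Proof.
apply: (@closed_equalizer _ G (fun p : G * G => src p.1)
  (fun p : G * G => rng p.2) hG) => p.
- by apply: (@continuous_comp _ _ _ fst (@src G)); [exact: cvg_fst|exact: src_continuous].
- by apply: (@continuous_comp _ _ _ snd (@rng G)); [exact: cvg_snd|exact: rng_continuous].
Qed.

Lemma same_source_closed : closed same_source.
Proof.
apply: (@closed_equalizer _ G (fun p : G * G => src p.1)
  (fun p : G * G => src p.2) hG) => p.
- by apply: (@continuous_comp _ _ _ fst (@src G)); [exact: cvg_fst|exact: src_continuous].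
- by apply: (@continuous_comp _ _ _ snd (@src G)); [exact: cvg_snd|exact: src_continuous].
Qed.

Lemma src_fiber_closed (x : G) : closed (src_fiber x).
Proof.
apply: (@closed_equalizer _ G (@src G) (fun=> x) hG); first exact: src_continuous.
by move=> y; exact: cvg_cst.
Qed.

Lemma eq0_off_support (f : G -> R[i]) (x : G) :
  ~ closure [set xi | f xi != 0] x -> f x = 0.
Proof.
move=> nx; apply/eqP; apply: contrapT => /negP fx.
by apply: nx; exact: subset_closure.
Qed.

Lemma CcP (f : G -> R[i]) : Cc f <->
  ccfun (fun x => complex.Re (f x)) /\ ccfun (fun x => complex.Im (f x)).
Proof.
split=> [[cf Kf]|[[cr [K cK rK]] [ci [L cL iL]]]].
  split; (split; last by exists (closure [set xi | f xi != 0]) => // x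
    /eq0_off_support ->).
    by move=> x; have /cvg_complexP[] := cf x.
  by move=> x; have /cvg_complexP[] := cf x.
split; first by move=> x; apply/cvg_complexP; split; [exact: cr|exact: ci].
have cKL : compact (K `|` L) by exact: compactU.
apply: (subclosed_compact _ cKL); first exact: closed_closure.
have /closure_id -> : closed (K `|` L) by exact: compact_closed.
apply: closureS => x /= fx; apply: contrapT => /not_orP[Kx Lx].
move: fx; case: (f x) (rK x Kx) (iL x Lx) => a b /= -> ->.
by rewrite eqxx.
Qed.

Hypothesis lcG : locally_compact [set: G].
Variable lam : G -> {measure set (borel G) -> \bar R}.
Hypothesis haar : right_haar_system lam.

(** The Haar axiom gives continuity on the unit space; composing with [src] turns it into continuity
    on all of [G], the form in which convolutions are written. *)
Lemma Rintegral_fiber_continuous (h : G -> R) : ccfun h ->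
  continuous (fun xi : G =>
    \int[lam (src xi)]_(eta in src_fiber (src xi)) h eta).
Proof.
move=> ch; apply/continuous_subspace_setT.
pose I x := \int[lam x]_(eta in src_fiber x) h eta.
have cI : {within unit_space G, continuous I}.
  pose hC x := (h x)%:C%C.
  have : Cc hC.
    by apply/CcP; split => //=; exact: ccfun0.
  move=> /(haar_continuous haar) /subspace_continuousP cC.
  by apply/subspace_continuousP => x /cC /cvg_complexP[].
apply: (@continuous_within_comp _ _ _ (@src G) I _ (unit_space G)) => //.
  by apply: continuous_subspaceT; exact: src_continuous.
by move=> x _; exact: unit_space_src.
Qed.

(* Near xi0, k (xi, .) is uniformly close to a fixed h in Cc(G) that extends
   k (xi0, .), for which continuity is part of the definition of a Haar system. *)
Lemma kernel_integral_continuous (k : G * G -> R) (L : set G) :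
  {within same_source, continuous k} -> compact L ->
  (forall p, same_source p -> ~ L p.2 -> k p = 0) ->
  continuous (fun xi : G =>
    \int[lam (src xi)]_(eta in src_fiber (src xi)) k (xi, eta)).
Proof.
move=> ck cL kL xi0.
have ckxi xi : {within src_fiber (src xi), continuous (fun eta => k (xi, eta))}.
  apply: (@continuous_within_comp _ _ _ (fun eta => (xi, eta)) k _ same_source) => //.
  apply: continuous_within_pair; apply: continuous_subspaceT => ?.
    exact: cvg_cst.
  exact: cvg_id.
have [h [ch hk [L' cL' hL']]] := compact_tietze hG lcG
  (@src_fiber_closed (src xi0)) cL (ckxi xi0)
  (fun eta se => kL (xi0, eta) (esym se)).
have cK : compact (L `|` L') by exact: compactU.
(* [phi] is 1 on both supports, so a uniform error on them integrates to at most that error times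
   [Phi]. Being continuous, [Phi] is bounded near [xi0], uniformly over the varying measures. *)
have [phi [cphi phi01 phi1 _ [L2 cL2 phi0]]] :=
  compact_urysohn R hG lcG cK openT (@subsetT _ _).
have ccphi : ccfun phi by split => //; exists L2.
have cch : ccfun h by split => //; exists L'.
pose Phi xi := \int[lam (src xi)]_(eta in src_fiber (src xi)) phi eta.
pose H xi := \int[lam (src xi)]_(eta in src_fiber (src xi)) h eta.
have cPhi : {for xi0, continuous Phi} by exact: Rintegral_fiber_continuous.
have cH : {for xi0, continuous H} by exact: Rintegral_fiber_continuous.
have Phi_ge0 xi : 0 <= Phi xi.
  by apply: Rintegral_ge0 => eta _; case/andP: (phi01 eta).
have unif e : 0 < e -> \forall xi \near xi0, (L `|` L') `<=`
    [set eta | src xi = src eta -> `|k (xi, eta) - h eta| <= e].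
  move=> e0; move/compact_near_coveringP : cK; apply=> eta _.
  (* If the sources differ, [same_source] being closed, no pair near [(xi0, eta)] has a common
     source and the condition is void there. Otherwise the continuity of [k] within [same_source]
     and that of [h] each contribute e/2. Compactness then makes the neighbourhood of [xi0]
     independent of [eta]. *)
  have [sE|sE] := pselect (src xi0 = src eta); last first.
    have oD : open (~` same_source) by apply: closed_openC; exact: same_source_closed.
    have : nbhs (xi0, eta) (~` same_source) by exact: open_nbhs_nbhs.
    move=> [[U V] /= [Uxi Veta] UV].
    exists (V, U) => //= -[a b] /= [Va Ub] /= ab.
    by have /(_ (conj Ub Va)) := UV (b, a).
  have e2 : 0 < e / 2 by rewrite divr_gt0.
  have hE : h eta = k (xi0, eta) by rewrite hk.
  move/subspace_continuousP : (ck) => /(_ (xi0, eta) sE) /cvgrPdist_lt /(_ _ e2).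
  rewrite /within /= => -[[U V] /= [Uxi Veta] UV].
  have /cvgrPdist_lt /(_ _ e2) hV := ch eta.
  exists (V `&` [set t | `|h eta - h t| < e / 2], U).
    by split => //=; exact: filterI.
  move=> [a b] /= [[Va ha] Ub] ab.
  have := UV (b, a) (conj Ub Va) ab; rewrite /from_subspace /= -hE.
  rewrite !ltr_norml ler_norml; move: ha; rewrite ltr_norml; lra.
apply/cvgrPdist_le => e e0.
(* The margin 1 makes [B] positive and an upper bound of [Phi] near [xi0]. With tolerance
   [e / 2 / B] on the kernel, the integrals differ by at most e/2. *)
pose B := Phi xi0 + 1.
have B0 : 0 < B by rewrite ltr_wpDl.
have e2 : 0 < e / 2 by rewrite divr_gt0.
have nPhi : \forall xi \near xi0, Phi xi <= B.
  have /cvgrPdist_le /(_ 1 ltr01) := cPhi; apply: filterS => xi.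
  by rewrite ler_norml /B; lra.
have /cvgrPdist_le /(_ _ e2) nH := cH.
have nU := unif _ (divr_gt0 e2 B0).
near=> xi.
have HE : \int[lam (src xi0)]_(eta in src_fiber (src xi0)) k (xi0, eta) = H xi0.
  by apply: eq_Rintegral => eta; rewrite inE => /hk.
rewrite HE; have [] : `|H xi0 - H xi| <= e / 2 /\
   `|H xi - \int[lam (src xi)]_(eta in src_fiber (src xi)) k (xi, eta)| <= e / 2.
  split; first by near: xi.
  have reg := haar_regular haar (unit_space_src xi).
  have fcl := @src_fiber_closed (src xi).
  have mfib := @closed_borel G _ fcl.
  have ih : (lam (src xi)).-integrable (src_fiber (src xi)) (EFin \o h).
    apply: (integrable_compact_support hG reg fcl cL' (continuous_subspaceT ch)).
    by move=> x _ /hL'.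
  have ik : (lam (src xi)).-integrable (src_fiber (src xi))
      (EFin \o (fun eta => k (xi, eta))).
    apply: (integrable_compact_support hG reg fcl cL (ckxi xi)).
    by move=> eta sE; exact: kL (xi, eta) (esym sE).
  have iphi : (lam (src xi)).-integrable (src_fiber (src xi)) (EFin \o phi).
    apply: (integrable_compact_support hG reg fcl cL2 (continuous_subspaceT cphi)).
    by move=> x _ /phi0.
  rewrite -RintegralB//.
  apply: (le_trans (le_normr_Rintegral _ _)) => //.
    exact: (@integrableB _ _ _ _ _ mfib _ _ ih ik).
  apply: (@le_trans _ _ (\int[lam (src xi)]_(eta in src_fiber (src xi))
      (e / 2 / B * phi eta))).
    apply: le_Rintegral => //.
    - by apply: integrable_norm; exact: (integrableB mfib ih ik).
    - apply: (integrable_compact_support hG reg fcl cL2).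
        by apply: continuous_subspaceT => t; apply: cvgM; [exact: cvg_cst|exact: cphi].
      by move=> t _ /phi0 ->; rewrite mulr0.
    move=> eta sE; have [KE|/not_orP[LE L'E]] := pselect ((L `|` L') eta).
      rewrite (phi1 _ KE) mulr1 distrC.
      by have := near nU xi; apply.
    rewrite hL'// (kL (xi, eta))// subr0 normr0 mulr_ge0//.
      by rewrite ltW// divr_gt0.
    by case/andP: (phi01 eta).
  rewrite RintegralZl//.
  apply: (@le_trans _ _ (e / 2 / B * B)); last by rewrite divfK// gt_eqF.
  rewrite ler_wpM2l//; first by rewrite ltW// divr_gt0.
  by near: xi.
by rewrite !ler_norml; lra.
Unshelve. all: by end_near. Qed.


Lemma gmulV_continuous :
  {within same_source, continuous (fun p : G * G => gmul p.1 (ginv p.2))}.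
Proof.
apply: (@continuous_within_comp _ _ _ (fun p : G * G => (p.1, ginv p.2))
  (fun p : G * G => gmul p.1 p.2) same_source composable).
- apply: continuous_within_pair; apply: continuous_subspaceT => p.
    exact: cvg_fst.
  by apply: (@continuous_comp _ _ _ snd (@ginv G));
    [exact: cvg_snd|exact: ginv_continuous].
- by move=> p; rewrite /composable /= rng_inv.
- exact: gmul_continuous.
Qed.

Variable omega : G -> G -> R[i].
Hypothesis cocycle : continuous_2cocycle omega.

(** The integrand of [twisted_conv] as a function of the pair, so that its continuity can be stated
    jointly on [same_source]. *)
Definition conv_kernel (f g : G -> R[i]) (p : G * G) : R[i]^o :=
  f (gmul p.1 (ginv p.2)) * g p.2 * omega (gmul p.1 (ginv p.2)) p.2.

Lemma conv_kernel_continuous f g :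
  continuous (f : G -> R[i]^o) -> continuous (g : G -> R[i]^o) ->
  {within same_source, continuous (conv_kernel f g)}.
Proof.
move=> cf cg.
have c1 : {within same_source,
    continuous (fun p : G * G => f (gmul p.1 (ginv p.2)) : R[i]^o)}.
  apply: (@continuous_within_comp _ _ _ (fun p : G * G => gmul p.1 (ginv p.2))
    (f : G -> R[i]^o) same_source setT) => //; first exact: gmulV_continuous.
  exact: continuous_subspaceT.
have c2 : {within same_source, continuous (fun p : G * G => g p.2 : R[i]^o)}.
  apply: continuous_subspaceT => p.
  by apply: (@continuous_comp _ _ _ snd (g : G -> R[i]^o)); [exact: cvg_snd|exact: cg].
have c3 : {within same_source, continuous (fun p : G * G =>
    omega (gmul p.1 (ginv p.2)) p.2 : R[i]^o)}.
  apply: (@continuous_within_comp _ _ _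
    (fun p : G * G => (gmul p.1 (ginv p.2), p.2))
    (fun p : G * G => omega p.1 p.2 : R[i]^o) same_source composable).
  - apply: continuous_within_pair; first exact: gmulV_continuous.
    by apply: continuous_subspaceT => p; exact: cvg_snd.
  - by move=> p pE; rewrite /composable /= src_mulV.
  - exact: cocycle_continuous cocycle.
by move=> p; apply: cvgM; [apply: cvgM; [exact: c1|exact: c2]|exact: c3].
Qed.

(** The convolution vanishes outside the product [KL] of the two supports, the image of a compact
    set of composable pairs. Continuity is that of kernel integrals, the support of [g] bounding the
    integration variable. *)
Lemma twisted_conv_Cc f g : Cc f -> Cc g -> Cc (twisted_conv lam omega f g).
Proof.
move=> Cf Cg; have [cf sf] := Cf; have [cg sg] := Cg.
have ck := conv_kernel_continuous cf cg.
pose K := closure [set xi | f xi != 0]; pose L := closure [set xi | g xi != 0].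
have fK x : ~ K x -> f x = 0 by exact: eq0_off_support.
have gL x : ~ L x -> g x = 0 by exact: eq0_off_support.
have kL p : same_source p -> ~ L p.2 -> conv_kernel f g p = 0.
  by move=> _ /gL; rewrite /conv_kernel => ->; rewrite mulr0 mul0r.
pose KL := (fun p : G * G => gmul p.1 p.2) @` ((K `*` L) `&` composable).
have cKL : compact KL.
  apply: continuous_compact.
    apply: continuous_subspaceW (@gmul_continuous G); exact: subIsetr.
  apply: compact_closedI; last exact: composable_closed.
  exact: compact_setX.
have conv0 xi : ~ KL xi -> twisted_conv lam omega f g xi = 0.
  move=> nxi; have k0 eta : src_fiber (src xi) eta -> conv_kernel f g (xi, eta) = 0.
    move=> sE; rewrite /conv_kernel /=.
    have [Le|/gL ->] := pselect (L eta); last by rewrite mulr0 mul0r.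
    have [Ke|/fK ->] := pselect (K (gmul xi (ginv eta))); last by rewrite !mul0r.
    exfalso; apply: nxi; exists (gmul xi (ginv eta), eta) => /=.
      by split => //; rewrite /composable /= src_mulV.
    by rewrite gmulKV.
  have E (h : R[i] -> R) : h 0 = 0 -> \int[lam (src xi)]_(eta in
      src_fiber (src xi)) h (conv_kernel f g (xi, eta)) = 0.
    move=> h0; rewrite (@eq_Rintegral _ _ _ _ _ (fun=> 0)); last first.
      by move=> eta; rewrite inE => /k0 ->.
    by rewrite /Rintegral integral0.
  by congr (Complex _ _); [exact: (E (@complex.Re R))|exact: (E (@complex.Im R))].
apply/CcP; split; (split; last by exists KL => // x /conv0 ->).
- apply: (kernel_integral_continuous (k := fun p => complex.Re (conv_kernel f g p)) _ sg).
    apply/subspace_continuousP => p Dp.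
    by move/subspace_continuousP : ck => /(_ p Dp) /cvg_complexP[].
  by move=> p Dp /(kL p Dp) ->.
- apply: (kernel_integral_continuous (k := fun p => complex.Im (conv_kernel f g p)) _ sg).
    apply/subspace_continuousP => p Dp.
    by move/subspace_continuousP : ck => /(_ p Dp) /cvg_complexP[].
  by move=> p Dp /(kL p Dp) ->.
Qed.

End GroupoidTopology.

(** * Propagation of the bound from one fiber to all fibers *)

Section Translation.
Context (R : realType) (G : topGroupoidType).
Hypotheses (hG : hausdorff_space G) (lcG : locally_compact [set: G]).
Variable lam : G -> {measure set (borel G) -> \bar R}.
Hypothesis haar : right_haar_system lam.

Lemma fiber_borel (x : G) : measurable (src_fiber x : set (borel G)).
Proof. by apply: closed_borel; exact: src_fiber_closed. Qed.

Lemma ge0_integral_fiber (x : G) (f : borel G -> \bar R) : unit_space G x ->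
  measurable_fun setT f -> (forall t, 0 <= f t)%E ->
  (\int[lam x]_t f t = \int[lam x]_(t in src_fiber x) f t)%E.
Proof.
move=> ux mf f0; rewrite (@ge0_negligible_integral _ _ _ _ setT
  (~` src_fiber x : set (borel G)))//.
- by rewrite setTD setCK.
- by apply: measurableC; exact: fiber_borel.
- exact: haar_fiber haar _ ux.
Qed.

Lemma right_translation_continuous (g : G) :
  {within src_fiber (rng g), continuous (fun eta => gmul eta g)}.
Proof.
apply: (@continuous_within_comp _ _ _ (fun eta : G => (eta, g))
  (fun p : G * G => gmul p.1 p.2) (src_fiber (rng g)) (@composable G)) => //.
  apply: continuous_within_pair; apply: continuous_subspaceT => t.
    exact: cvg_id.
  exact: cvg_cst.
exact: gmul_continuous.
Qed.

Section Translate.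
Variable g : G.
Let x := rng g.
Let y := src g.

(* The value outside of the fiber of x is irrelevant, but T has to be Borel on
   all of G. *)
Let T (eta : borel G) : borel G := if src eta == x then gmul eta g else g.

Let mT : measurable_fun setT T.
Proof.
refine (@measurability _ _ (borel G) (borel G) setT T (@open G) _ _) => //.
move=> _ [V oV <-]; rewrite setTI.
have /open_subspaceP[W oW WV] :
    open ((fun eta => gmul eta g) @^-1` V : set (subspace (src_fiber x))).
  by have /continuousP := @right_translation_continuous g; apply.
have -> : T @^-1` V = (W `&` src_fiber x) `|` (~` src_fiber x `&` [set eta | V g]).
  rewrite WV; apply/seteqP; split=> eta; rewrite /T /=.
    case: eqP => [xE Ve|xE Vg]; first by left.
    by right.
  by move=> [[Ve ->]|[xE Vg]]; rewrite ?eqxx//; case: eqP.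
apply: measurableU; apply: measurableI.
- exact: open_borel.
- exact: fiber_borel.
- by apply: measurableC; exact: fiber_borel.
- have [Vg|Vg] := pselect (V g).
    by rewrite (_ : [set _ | _] = setT)//; apply/seteqP; split.
  by rewrite (_ : [set _ | _] = set0)//; apply/seteqP; split.
Qed.

Let ge0_integral_translate (f : borel G -> \bar R) :
  measurable_fun (src_fiber y : set (borel G)) f -> (forall t, 0 <= f t)%E ->
  (\int[lam y]_(t in src_fiber y) f t =
   \int[lam x]_(t in src_fiber x) f (gmul t g))%E.
Proof.
move=> mf f0; have ux : unit_space G x by exact: unit_space_rng.
(* The default value [g] itself has source [y], so [T] maps all of [G] into the fiber of [y]. *)
have TV : T @^-1` (src_fiber y) = setT.
  apply/seteqP; split => // eta _; rewrite /T /src_fiber /=.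
  by case: eqP => // xE; rewrite src_mul.
have mfT : measurable_fun setT (f \o T).
  apply: (@measurable_comp _ _ _ _ _ _ (src_fiber y : set (borel G))) mT => //.
    exact: fiber_borel.
  by move=> _ [eta _ <-]; rewrite -[src_fiber y _]/((T @^-1` src_fiber y) eta) TV.
transitivity (\int[lam x]_t (f \o T) t)%E; last first.
  rewrite ge0_integral_fiber//; last by move=> t; exact: f0.
  by apply: eq_integral => eta; rewrite inE /T /= => ->; rewrite eqxx.
rewrite -TV -(ge0_integral_pushforward mT)//; last exact: fiber_borel.
apply: eq_measure_integral => A mA _.
rewrite /pushforward (haar_invariant haar g mA) /=.
have mTA : measurable (T @^-1` A : set (borel G)).
  by rewrite -[_ @^-1` _]setTI; exact: mT.
(* Haar invariance says that [lam y] is the image of [lam x] under [T], up to the part of the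
   preimage outside the fiber of [x], which is negligible. *)
have -> : src_fiber (rng g) `&` [set eta | A (gmul eta g)] =
    (T @^-1` A) `\` ~` src_fiber x.
  apply/seteqP; split=> eta /= []; rewrite /T.
    by move=> xE Ae; split; [case: eqP|exact].
  by case: eqP => [xE Ae _|xE _ []//]; split.
have mN : measurable (~` src_fiber x : set (borel G)).
  by apply: measurableC; exact: fiber_borel.
have -> : lam x ((T @^-1` A) `\` ~` src_fiber x) = lam x (T @^-1` A).
  rewrite [RHS](measureDI (lam x) mTA mN).
  rewrite [X in (_ + X)%E](_ : _ = 0%E) ?adde0//.
  apply: (subset_measure0 _ mN); first exact: measurableI.
    exact: subIsetr.
  exact: haar_fiber haar _ ux.
by [].
Qed.

Lemma integral_translate (f : borel G -> \bar R) :
  measurable_fun (src_fiber y : set (borel G)) f ->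
  (\int[lam y]_(t in src_fiber y) f t =
   \int[lam x]_(t in src_fiber x) f (gmul t g))%E.
Proof.
move=> mf; rewrite integralE [RHS]integralE; congr (_ - _)%E.
  rewrite (ge0_integral_translate (measurable_funepos mf) (funepos_ge0 f)).
  by apply: eq_integral => t _; rewrite !funeposE.
rewrite (ge0_integral_translate (measurable_funeneg mf) (funeneg_ge0 f)).
by apply: eq_integral => t _; rewrite !funenegE.
Qed.

Lemma Rintegral_translate (f : borel G -> R) :
  measurable_fun (src_fiber y : set (borel G)) f ->
  \int[lam y]_(t in src_fiber y) f t =
  \int[lam x]_(t in src_fiber x) f (gmul t g).
Proof.
move=> mf; rewrite /Rintegral integral_translate//.
exact/measurable_EFinP.
Qed.

End Translate.

Lemma Cc_cmeasurable (f : G -> R[i]) : Cc f ->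
  cmeasurable (f : borel G -> R[i]).
Proof. by move=> /(CcP hG)[[cr _] [ci _]]; split; exact: continuous_borel. Qed.

Lemma l2sq_fiber (x : G) (u : borel G -> R[i]) : unit_space G x ->
  cmeasurable u ->
  l2sq (lam x) u = (\int[lam x]_(t in src_fiber x) (normc (u t) ^+ 2)%:E)%E.
Proof.
move=> ux mu; rewrite -integral_sqr_normc// ge0_integral_fiber//.
  by apply: measurable_sq; have [mr mi] := mu; exact: measurable_normc.
by move=> t; rewrite lee_fin sqr_ge0.
Qed.

Lemma CintegralZ (mu : {measure set (borel G) -> \bar R}) (D : set (borel G))
    (c : R[i]) (k : borel G -> R[i]) : measurable D ->
  mu.-integrable D (EFin \o (fun t => complex.Re (k t))) ->
  mu.-integrable D (EFin \o (fun t => complex.Im (k t))) ->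
  Cintegral mu D (fun t => c * k t) = c * Cintegral mu D k.
Proof.
move=> mD ir ii; rewrite /Cintegral; case: c => a b.
have iZ (r : R) (f : borel G -> R) : mu.-integrable D (EFin \o f) ->
    mu.-integrable D (EFin \o (fun t => r * f t)).
  move=> fi; have := integrableZl mD r fi.
  by apply: eq_integrable => // t _.
set I1 := \int[mu]_(t in D) complex.Re (k t).
set I2 := \int[mu]_(t in D) complex.Im (k t).
transitivity (Complex (a * I1 - b * I2) (a * I2 + b * I1)); last by [].
congr (Complex _ _).
  rewrite -!RintegralZl// -RintegralB//; [|exact: iZ|exact: iZ].
  by apply: eq_Rintegral => t _; case: (k t).
rewrite -!RintegralZl// -RintegralD//; [|exact: iZ|exact: iZ].
by apply: eq_Rintegral => t _; case: (k t).
Qed.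

Variable omega : G -> G -> R[i].
Hypothesis cocycle : continuous_2cocycle omega.

(** This is why left convolution commutes with right translation: the argument at which [F] is
    evaluated in the kernel is the same on both fibers. *)
Lemma gmul_translate (eta theta g : G) : src eta = rng g -> src theta = rng g ->
  gmul (gmul eta g) (ginv (gmul theta g)) = gmul eta (ginv theta).
Proof.
move=> eg tg; have et : src eta = src theta by rewrite eg tg.
have sa : src (gmul eta (ginv theta)) = rng (gmul theta g).
  by rewrite src_mulV// rng_mul.
have -> : gmul eta g = gmul (gmul eta (ginv theta)) (gmul theta g).
  by rewrite -gmulA// ?gmulKV// src_mulV.
by rewrite gmulA// ?rng_inv// gmulV -sa gmul_src.
Qed.

Lemma omega_neq0 (xi eta : G) : src xi = rng eta -> omega xi eta != 0.
Proof.
by move=> h; rewrite -normr_eq0 (cocycle_norm cocycle h) oner_eq0.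
Qed.

Lemma normc_omega (xi eta : G) : src xi = rng eta -> normc (omega xi eta) = 1.
Proof.
by move=> h; have := cocycle_norm cocycle h; rewrite normc_def;
  case: (omega _ _) => a b [].
Qed.

Lemma conv_kernel_integrable (f g : G -> R[i]) (h : R[i] -> R) (xi : G) :
  Cc f -> Cc g -> h 0 = 0 ->
  {within src_fiber (src xi), continuous
    (fun eta => h (conv_kernel omega f g (xi, eta)))} ->
  (lam (src xi)).-integrable (src_fiber (src xi) : set (borel G))
    (EFin \o (fun eta => h (conv_kernel omega f g (xi, eta)))).
Proof.
move=> Cf [_ sg] h0 ch.
have reg := haar_regular haar (unit_space_src xi).
apply: (integrable_compact_support hG reg (@src_fiber_closed _ hG _) sg ch).
move=> eta _ /eq0_off_support ge.
by rewrite /conv_kernel /= ge mulr0 mul0r.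
Qed.

Lemma conv_kernel_fiber_continuous (f g : G -> R[i]) (xi : G) :
  continuous (f : G -> R[i]^o) -> continuous (g : G -> R[i]^o) ->
  {within src_fiber (src xi), continuous
    (fun eta => complex.Re (conv_kernel omega f g (xi, eta)))} /\
  {within src_fiber (src xi), continuous
    (fun eta => complex.Im (conv_kernel omega f g (xi, eta)))}.
Proof.
move=> cf cg.
have : {within src_fiber (src xi), continuous
    (conv_kernel omega f g \o (fun eta : G => (xi, eta)))}.
  apply: (@continuous_within_comp _ _ _ (fun eta : G => (xi, eta))
    (conv_kernel omega f g) (src_fiber (src xi)) (@same_source G)) => //.
    apply: continuous_within_pair; apply: continuous_subspaceT => t.
      exact: cvg_cst.
    exact: cvg_id.
  exact: conv_kernel_continuous.
move=> /subspace_continuousP c.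
by split; apply/subspace_continuousP => eta /c /cvg_complexP[].
Qed.

Lemma conv_bound_translate (F : G -> R[i]) (C : \bar R) (g : G) : Cc F ->
  (forall w, Cc w -> (l2sq (lam (rng g)) (twisted_conv lam omega F w) <=
     C * l2sq (lam (rng g)) w)%E) ->
  forall u, Cc u -> (l2sq (lam (src g)) (twisted_conv lam omega F u) <=
     C * l2sq (lam (src g)) u)%E.
Proof.
move=> CF H u Cu; have [cu su] := Cu.
set x := rng g in H *; set y := src g.
have ux : unit_space G x by exact: unit_space_rng.
have uy : unit_space G y by exact: unit_space_src.
pose S := closure [set xi | u xi != 0].
have uS t : ~ S t -> u t = 0 by exact: eq0_off_support.
(* By the cocycle identity, convolving v by F on the fiber of x amounts to
   convolving u by F on the fiber of y, up to the unimodular factor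
   omega (., g). *)
pose v (theta : G) : R[i]^o := u (gmul theta g) * (omega theta g)^-1.
have cv : {within src_fiber x, continuous v}.
  have c1 : {within src_fiber x, continuous (fun t => u (gmul t g) : R[i]^o)}.
    apply: (@continuous_within_comp _ _ _ (fun t => gmul t g)
      (u : G -> R[i]^o) (src_fiber x) setT) => //.
      exact: right_translation_continuous.
    exact: continuous_subspaceT.
  have c2 : {within src_fiber x, continuous (fun t => omega t g : R[i]^o)}.
    apply: (@continuous_within_comp _ _ _ (fun t : G => (t, g))
      (fun p : G * G => omega p.1 p.2 : R[i]^o) (src_fiber x) (@composable G)) => //.
      apply: continuous_within_pair; apply: continuous_subspaceT => t.
        exact: cvg_id.
      exact: cvg_cst.
    exact: cocycle_continuous cocycle.
  apply/subspace_continuousP => t tx; apply: cvgM.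
    by move/subspace_continuousP : c1; exact.
  apply: cvgV; first exact: omega_neq0.
  by move/subspace_continuousP : c2; exact.
(* On the fiber of [x], the function [v] is supported in the translate of the support of [u] by the
   inverse of [g]. *)
pose L := (fun t => gmul t (ginv g)) @` (S `&` src_fiber y).
have cL : compact L.
  apply: continuous_compact.
    apply: continuous_subspaceW (@right_translation_continuous (ginv g)).
    by rewrite rng_inv; exact: subIsetr.
  by apply: compact_closedI => //; exact: src_fiber_closed.
have vL t : src_fiber x t -> ~ L t -> v t = 0.
  move=> tx nt; rewrite /v uS ?mul0r// => St; apply: nt.
  exists (gmul t g); first by split => //; rewrite /src_fiber /= src_mul.
  by rewrite gmulA ?rng_inv// gmulV -/x -tx gmul_src.
have xcl := @src_fiber_closed _ hG x.
have [cvr cvi] : {within src_fiber x, continuous (fun t => complex.Re (v t))} /\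
    {within src_fiber x, continuous (fun t => complex.Im (v t))}.
  by move/subspace_continuousP : cv => cv; split;
    apply/subspace_continuousP => t /cv /cvg_complexP[].
(* [v] is meaningful on the fiber of [x] only, whereas [H] speaks of functions of Cc(G). Only the
   values on the fiber enter the norms and the convolution, so any extension serves. *)
have [wr [cwr wrE swr]] := compact_tietze hG lcG xcl cL cvr
  (fun t tx nt => congr1 (@complex.Re R) (vL t tx nt)).
have [wi [cwi wiE swi]] := compact_tietze hG lcG xcl cL cvi
  (fun t tx nt => congr1 (@complex.Im R) (vL t tx nt)).
pose w t : R[i] := Complex (wr t) (wi t).
have Cw : Cc w by apply/(CcP hG); split; split.
have wE t : src_fiber x t -> w t = v t.
  by move=> tx; rewrite /w wrE// wiE//; case: (v t).
have convE eta : src_fiber x eta -> twisted_conv lam omega F u (gmul eta g) =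
    omega eta g * twisted_conv lam omega F w eta.
  move=> ex; have Fx : src eta = x by [].
  have kE theta : src_fiber x theta ->
      conv_kernel omega F u (gmul eta g, gmul theta g) =
      omega eta g * conv_kernel omega F w (eta, theta).
    move=> tx; rewrite /conv_kernel /= gmul_translate// wE// /v.
    have tE : src theta = rng g by [].
    have st : src (gmul eta (ginv theta)) = rng theta.
      by rewrite src_mulV// Fx tE.
    (* The cocycle identity for [gmul eta (ginv theta)], [theta], [g]. The factor [omega theta g]
       that it produces is cancelled by its inverse in [v], and what remains, [omega eta g], is free
       of [theta] and leaves the integral. *)
    have := cocycleE cocycle st tE; rewrite gmulKV ?Fx ?tE// => coc.
    have := omega_neq0 tE; move: coc; set o := omega theta g => coc o0.
    have -> : omega (gmul eta (ginv theta)) (gmul theta g) =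
        o^-1 * (omega (gmul eta (ginv theta)) theta * omega eta g).
      by rewrite coc mulKf.
    by rewrite -/o; ring.
  have sy : src (gmul eta g) = y by rewrite src_mul.
  have mf := fiber_borel x.
  have [k1 k2] := conv_kernel_fiber_continuous eta CF.1 Cw.1.
  have i1 := conv_kernel_integrable CF Cw (erefl _) k1.
  have i2 := conv_kernel_integrable CF Cw (erefl _) k2.
  rewrite Fx in i1 i2.
  rewrite {2}/twisted_conv Fx -CintegralZ//.
  have [q1 q2] := conv_kernel_fiber_continuous (gmul eta g) CF.1 cu.
  rewrite sy in q1 q2.
  rewrite /twisted_conv sy /Cintegral; congr (Complex _ _).
    rewrite (Rintegral_translate (g := g)
      (f := fun t => complex.Re (conv_kernel omega F u (gmul eta g, t)))).
      by apply: eq_Rintegral => t; rewrite inE => /kE ->.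
    by apply: within_continuous_borel => //; exact: src_fiber_closed.
  rewrite (Rintegral_translate (g := g)
    (f := fun t => complex.Im (conv_kernel omega F u (gmul eta g, t)))).
    by apply: eq_Rintegral => t; rewrite inE => /kE ->.
  by apply: within_continuous_borel => //; exact: src_fiber_closed.
have l2E (a b : G -> R[i]) : Cc a -> Cc b ->
    (forall t, src_fiber x t -> normc (a (gmul t g)) = normc (b t)) ->
    l2sq (lam y) a = l2sq (lam x) b.
  move=> Ca Cb ab; have ma := Cc_cmeasurable Ca.
  have mb := Cc_cmeasurable Cb.
  rewrite !l2sq_fiber// integral_translate//.
    by apply: eq_integral => t; rewrite inE => /ab ->.
  apply: measurable_funTS; apply: measurable_sq.
  by have [mr mi] := ma; exact: measurable_normc.
have /H := Cw.
have -> : l2sq (lam y) (twisted_conv lam omega F u) =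
    l2sq (lam x) (twisted_conv lam omega F w).
  apply: l2E; [exact: twisted_conv_Cc..|].
  by move=> t tx; rewrite convE// normcM normc_omega ?mul1r.
have -> // : l2sq (lam y) u = l2sq (lam x) w.
apply: l2E => // t tx; rewrite wE// /v normcM.
have o1 := normc_omega tx; have o0 := omega_neq0 tx.
have : normc (omega t g) * normc (omega t g)^-1 = 1 by rewrite -normcM mulfV// normc1.
by rewrite o1 mul1r => ->; rewrite mulr1.
Qed.

End Translation.

(** * From one fiber to the orbit, to its closure, and to all L^2 vectors *)

Section Bound.
Context (R : realType) (G : topGroupoidType).
Hypotheses (hG : hausdorff_space G) (lcG : locally_compact [set: G]).
Variable lam : G -> {measure set (borel G) -> \bar R}.
Hypothesis haar : right_haar_system lam.
Variable omega : G -> G -> R[i].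
Hypothesis cocycle : continuous_2cocycle omega.

Lemma unit_space_srcE (x : G) : unit_space G x -> src x = x.
Proof. by move=> [t _ <-]; exact: src_src. Qed.

(** The square of the modulus of [u] is again in Cc(G), so its fiber integral is continuous. [Phi]
    is defined on all of [G], through [src], because the closure of the orbit is taken in [G]. *)
Lemma l2sq_Cc (u : G -> R[i]) : Cc u -> exists2 Phi : G -> R,
  continuous Phi & forall x, unit_space G x -> l2sq (lam x) u = (Phi x)%:E.
Proof.
move=> Cu; have /(CcP hG)[cr ci] := Cu.
pose h t := complex.Re (u t) * complex.Re (u t) +
            complex.Im (u t) * complex.Im (u t).
have ch : ccfun h by apply: ccfunD; [exact: ccfunM cr.1 cr|exact: ccfunM ci.1 ci].
exists (fun x => \int[lam (src x)]_(t in src_fiber (src x)) h t).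
  exact: Rintegral_fiber_continuous.
move=> x ux; rewrite unit_space_srcE// l2sq_fiber//; last exact: Cc_cmeasurable.
have [c [L cL hL]] := ch.
have reg := haar_regular haar ux.
have ih := integrable_compact_support hG reg (@src_fiber_closed _ hG x) cL
  (continuous_subspaceT c) (fun t _ => hL t).
rewrite /Rintegral fineK; last first.
  exact: (integrable_fin_num (fiber_borel hG x) ih).
by apply: eq_integral => t _; rewrite normc_sqE /h !expr2.
Qed.

(** If [a] and [b] are arrows from [z] to [x] and to [y], then [gmul a (ginv b)] is an arrow from
    [y] to [x], along which the bound is translated. *)
Lemma conv_bound_orbit (F : G -> R[i]) (C : R) (x y z : G) : Cc F ->
  groupoid_orbit z x -> groupoid_orbit z y ->
  (forall w, Cc w -> (l2sq (lam x) (twisted_conv lam omega F w) <=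
     C%:E * l2sq (lam x) w)%E) ->
  forall u, Cc u -> (l2sq (lam y) (twisted_conv lam omega F u) <=
     C%:E * l2sq (lam y) u)%E.
Proof.
move=> CF [a az <-] [b bz <-] H u Cu.
have ab : src a = src b by rewrite az bz.
have sg : src (gmul a (ginv b)) = rng b by exact: src_mulV.
have rg : rng (gmul a (ginv b)) = rng a by rewrite rng_mul// rng_inv.
rewrite -sg; apply: conv_bound_translate => // w Cw.
by rewrite rg; exact: H.
Qed.

Lemma conv_bound_dense (F : G -> R[i]) (C : R) (x z : G) : Cc F ->
  unit_space G `<=` closure (groupoid_orbit z) -> groupoid_orbit z x ->
  (forall w, Cc w -> (l2sq (lam x) (twisted_conv lam omega F w) <=
     C%:E * l2sq (lam x) w)%E) ->
  forall y u, unit_space G y -> Cc u ->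
    (l2sq (lam y) (twisted_conv lam omega F u) <= C%:E * l2sq (lam y) u)%E.
Proof.
move=> CF dense zx H y u uy Cu.
have [Phi cPhi PhiE] := l2sq_Cc (twisted_conv_Cc hG lcG haar cocycle CF Cu).
have [Psi cPsi PsiE] := l2sq_Cc Cu.
have closedS : closed [set t | 0 <= C * Psi t - Phi t].
  apply: (@preimage_closed _ _ (fun t => C * Psi t - Phi t) [set r | 0 <= r]).
    move=> t _; apply: cvgB; last exact: cPhi.
    by apply: cvgM; [exact: cvg_cst|exact: cPsi].
  exact: closed_ge.
rewrite PhiE// PsiE// -EFinM lee_fin -subr_ge0.
suff : closure (groupoid_orbit z) `<=` [set t | 0 <= C * Psi t - Phi t].
  by apply; exact: dense.
rewrite [X in _ `<=` X](closure_id _).1//; apply: closureS => t zt /=.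
have ut : unit_space G t by have [s _ <-] := zt; exact: unit_space_rng.
rewrite subr_ge0 -lee_fin EFinM -PhiE// -PsiE//.
exact: (conv_bound_orbit CF zx zt H Cu).
Qed.

Section L2Bound.
Variables (y : G) (uy : unit_space G y) (F : G -> R[i]) (CF : Cc F) (C : R).
Hypothesis C0 : 0 <= C.
Hypothesis FC : forall u, Cc u ->
  (l2sq (lam y) (twisted_conv lam omega F u) <= C%:E * l2sq (lam y) u)%E.
Let D : set (borel G) := src_fiber y.
Let mD : measurable D := fiber_borel hG y.

Section Pointwise.
Variables (xi : G) (xiy : src xi = y).
(** The weight against which [g] is integrated in the value of the convolution at [xi]; it does not
    involve [g]. *)
Let a (eta : borel G) : R[i] := conv_kernel omega F (fun=> 1) (xi, eta).

Let a_continuous : {within src_fiber y, continuous (fun t => complex.Re (a t))} /\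
  {within src_fiber y, continuous (fun t => complex.Im (a t))}.
Proof.
rewrite -xiy; apply: conv_kernel_fiber_continuous => //; first exact: CF.1.
by move=> t; exact: cvg_cst.
Qed.

Let a_support : exists2 L : set G, compact L &
  forall t, src_fiber y t -> ~ L t -> a t = 0.
Proof.
pose K := closure [set t | F t != 0].
(* If [b = gmul xi (ginv t)] lies in [K], then [t = gmul (ginv b) xi]: the support is the inverse of
   [K] translated by [xi]. *)
exists ((fun t => gmul t xi) @` ((@ginv G @` K) `&` src_fiber (rng xi))).
  apply: continuous_compact.
    apply: continuous_subspaceW (@right_translation_continuous G xi).
    exact: subIsetr.
  apply: compact_closedI; last exact: src_fiber_closed.
  apply: continuous_compact; last exact: CF.2.
  by apply: continuous_subspaceT; exact: ginv_continuous.
move=> t ty nt; rewrite /a /conv_kernel /= (_ : F _ = 0) ?mul0r//.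
apply: eq0_off_support => Ft; apply: nt.
have xit : src xi = src t by rewrite xiy.
pose b := gmul xi (ginv t).
have bt : src b = rng t by exact: src_mulV.
exists (ginv b).
  split; last by rewrite /src_fiber /= src_inv rng_mul// rng_inv.
  by exists b.
have -> : gmul (ginv b) xi = gmul (ginv b) (gmul b t) by rewrite gmulKV.
by rewrite -gmulA ?src_inv// gmulVg bt gmul_rng.
Qed.

Let a_sqint (h : R[i] -> R) : h 0 = 0 ->
  {within src_fiber y, continuous (fun t => h (a t))} ->
  exists A : R, 0 <= A /\ (\int[lam y]_(t in D) ((h (a t)) ^+ 2)%:E <= A%:E)%E.
Proof.
move=> h0 ch; have [L cL aL] := a_support.
have reg := haar_regular haar uy.
have ch2 : {within src_fiber y, continuous (fun t => h (a t) * h (a t))}.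
  apply/subspace_continuousP => t ty.
  by apply: cvgM; move/subspace_continuousP : ch; exact.
have h20 t : src_fiber y t -> ~ L t -> h (a t) * h (a t) = 0.
  by move=> ty /(aL t ty) ->; rewrite h0 mulr0.
have ih := integrable_compact_support hG reg (@src_fiber_closed _ hG y) cL ch2 h20.
exists (fine (\int[lam y]_(t in D) ((h (a t)) ^+ 2)%:E)%E); split.
  by apply: fine_ge0; apply: integral_ge0 => t _; rewrite lee_fin sqr_ge0.
by rewrite fineK//; exact: (integrable_fin_num mD ih).
Qed.

Let conv_aE (g : borel G -> R[i]) : twisted_conv lam omega F g xi =
  Complex (\int[lam y]_(t in D) (complex.Re (a t) * complex.Re (g t)
             - complex.Im (a t) * complex.Im (g t)))
          (\int[lam y]_(t in D) (complex.Re (a t) * complex.Im (g t)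
             + complex.Im (a t) * complex.Re (g t))).
Proof.
have E t : F (gmul xi (ginv t)) * g t * omega (gmul xi (ginv t)) t = a t * g t.
  by rewrite /a /conv_kernel /= mulr1 mulrAC.
rewrite /twisted_conv /Cintegral xiy; congr (Complex _ _);
  by apply: eq_Rintegral => t _; rewrite E; case: (a t) (g t) => [? ?] [? ?].
Qed.

(** The weight [a] is continuous with compact support on the fiber, hence square-integrable, so
    evaluation of the convolution at [xi] is controlled by the L^2 distance. [K] depends on [F] and
    [xi] but not on [g], [g'], [r]. *)
Lemma conv_pointwise_le : exists2 K : R, 0 <= K & forall (g g' : borel G -> R[i]) (r : R),
  cmeasurable g -> cmeasurable g' ->
  (l2sq (lam y) g < +oo)%E -> (l2sq (lam y) g' < +oo)%E -> 0 < r ->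
  (l2sq (lam y) (g \- g')%R <= (r ^+ 2)%:E)%E ->
  `|complex.Re (twisted_conv lam omega F g xi) -
    complex.Re (twisted_conv lam omega F g' xi)| <= r * K /\
  `|complex.Im (twisted_conv lam omega F g xi) -
    complex.Im (twisted_conv lam omega F g' xi)| <= r * K.
Proof.
have [car cai] := a_continuous.
have [A [A0 aA]] := a_sqint (erefl _) car.
have [B [B0 aB]] := a_sqint (erefl _) cai.
have mar := within_continuous_borel (@src_fiber_closed _ hG y) car.
have mai := within_continuous_borel (@src_fiber_closed _ hG y) cai.
(* Either component of [a t * g t] is made of one product with the real part of [a] and one with its
   imaginary part; each contributes one summand. *)
exists ((A + 1) / 2 + (B + 1) / 2).
  by rewrite addr_ge0// divr_ge0// addr_ge0.
have sub (h : borel G -> R) : measurable_fun setT h ->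
    (\int[lam y]_(t in D) ((h t) ^+ 2)%:E <= sqint (lam y) h)%E.
  move=> mh; apply: ge0_subset_integral => //; first exact: measurable_sq.
  by move=> t _; rewrite lee_fin sqr_ge0.
have leRe (g : borel G -> R[i]) :
    (sqint (lam y) (fun t => complex.Re (g t)) <= l2sq (lam y) g)%E.
  by rewrite /l2sq leeDl// sqint_ge0.
have leIm (g : borel G -> R[i]) :
    (sqint (lam y) (fun t => complex.Im (g t)) <= l2sq (lam y) g)%E.
  by rewrite /l2sq leeDr// sqint_ge0.
have sqfin (h : borel G -> R) : measurable_fun setT h ->
    (sqint (lam y) h < +oo)%E ->
    exists2 s, 0 < s & (\int[lam y]_(t in D) ((h t) ^+ 2)%:E <= (s ^+ 2)%:E)%E.
  move=> mh hoo; pose N := fine (sqint (lam y) h).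
  have N0 : 0 <= N by rewrite fine_ge0// sqint_ge0.
  (* [N <= (N + 1) ^+ 2] spares a square root and keeps the witness positive when [N] is 0. *)
  exists (N + 1); first by rewrite ltr_wpDl.
  apply: (le_trans (sub _ mh)).
  rewrite -[leLHS]fineK ?ge0_fin_numE ?sqint_ge0// lee_fin -/N; nra.
have prod_int (b h : borel G -> R) (E : R) : measurable_fun D b ->
    (\int[lam y]_(t in D) ((b t) ^+ 2)%:E <= E%:E)%E ->
    measurable_fun setT h -> (sqint (lam y) h < +oo)%E ->
    (lam y).-integrable D (EFin \o (fun t => b t * h t)).
  move=> mb bE mh hoo; have [s s0 hs] := sqfin _ mh hoo.
  exact: (integrable_sqM mD mb (measurable_funTS mh) s0 bE hs).
have prod_le (b h h' : borel G -> R) (E r : R) : measurable_fun D b ->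
    (\int[lam y]_(t in D) ((b t) ^+ 2)%:E <= E%:E)%E ->
    measurable_fun setT h -> measurable_fun setT h' -> 0 < r ->
    (sqint (lam y) h < +oo)%E -> (sqint (lam y) h' < +oo)%E ->
    (sqint (lam y) (h \- h')%R <= (r ^+ 2)%:E)%E ->
    `|\int[lam y]_(t in D) (b t * h t) - \int[lam y]_(t in D) (b t * h' t)|
      <= r * (E + 1) / 2.
  move=> mb bE mh mh' r0 hoo h'oo hh'.
  have mhh' : measurable_fun setT (h \- h') by exact: measurable_funB.
  rewrite -RintegralB//; [|exact: prod_int bE mh hoo|exact: prod_int bE mh' h'oo].
  rewrite (@eq_Rintegral _ _ _ _ _ (fun t => b t * (h \- h') t)); last first.
    by move=> t _; rewrite /= mulrBr.
  apply: (Rintegral_sqM_le mD mb (measurable_funTS mhh') r0 bE).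
  exact: le_trans (sub _ mhh') hh'.
move=> g g' r [mgr mgi] [mgr' mgi'] goo g'oo r0 gg'.
have BR : (sqint (lam y) ((fun t => complex.Re (g t)) \-
    (fun t => complex.Re (g' t)))%R <= (r ^+ 2)%:E)%E.
  apply: le_trans (le_trans (leRe _) gg'); rewrite le_eqVlt; apply/orP; left.
  by apply/eqP; congr sqint; apply/funext => t /=; case: (g t) (g' t) => [? ?] [? ?].
have BI : (sqint (lam y) ((fun t => complex.Im (g t)) \-
    (fun t => complex.Im (g' t)))%R <= (r ^+ 2)%:E)%E.
  apply: le_trans (le_trans (leIm _) gg'); rewrite le_eqVlt; apply/orP; left.
  by apply/eqP; congr sqint; apply/funext => t /=; case: (g t) (g' t) => [? ?] [? ?].
have [goR g'oR] := (le_lt_trans (leRe g) goo, le_lt_trans (leRe g') g'oo).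
have [goI g'oI] := (le_lt_trans (leIm g) goo, le_lt_trans (leIm g') g'oo).
rewrite !conv_aE /=; split.
  rewrite !RintegralB//; try by [apply: prod_int; eassumption].
  have := prod_le _ _ _ _ _ mar aA mgr mgr' r0 goR g'oR BR.
  have := prod_le _ _ _ _ _ mai aB mgi mgi' r0 goI g'oI BI.
  by rewrite !ler_norml; lra.
rewrite !RintegralD//; try by [apply: prod_int; eassumption].
have := prod_le _ _ _ _ _ mar aA mgi mgi' r0 goI g'oI BI.
have := prod_le _ _ _ _ _ mai aB mgr mgr' r0 goR g'oR BR.
by rewrite !ler_norml; lra.
Qed.

End Pointwise.

Lemma twisted_conv_off (g : G -> R[i]) (xi : G) :
  (forall t, ~ src_fiber y t -> g t = 0) -> src xi <> y ->
  twisted_conv lam omega F g xi = 0.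
Proof.
move=> g0 xiy; rewrite /twisted_conv /Cintegral.
have E (h : R[i] -> R) : h 0 = 0 -> \int[lam (src xi)]_(t in src_fiber (src xi))
    h (F (gmul xi (ginv t)) * g t * omega (gmul xi (ginv t)) t) = 0.
  move=> h0; rewrite (@eq_Rintegral _ _ _ _ _ (fun=> 0)).
    by rewrite /Rintegral integral0.
  move=> t; rewrite inE => tx; rewrite g0 ?mulr0 ?mul0r// => ty.
  by apply: xiy; rewrite -ty -tx.
by congr (Complex _ _); [exact: (E (@complex.Re R))|exact: (E (@complex.Im R))].
Qed.

Lemma Cc_dense_l2sq (g : borel G -> R[i]) (e : R) : cmeasurable g ->
  (l2sq (lam y) g < +oo)%E -> 0 < e ->
  exists2 u, Cc u & (l2sq (lam y) (g \- u)%R <= e%:E)%E.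
Proof.
move=> [mr mi] goo e0; have e2 : 0 < e / 2 by rewrite divr_gt0.
have reg := haar_regular haar uy.
have roo : (sqint (lam y) (fun t => complex.Re (g t)) < +oo)%E.
  by apply: le_lt_trans goo; rewrite /l2sq leeDl// sqint_ge0.
have ioo : (sqint (lam y) (fun t => complex.Im (g t)) < +oo)%E.
  by apply: le_lt_trans goo; rewrite /l2sq leeDr// sqint_ge0.
have [p cp pE] := cc_dense_sqint hG lcG reg mr roo e2.
have [q cq qE] := cc_dense_sqint hG lcG reg mi ioo e2.
exists (fun t => Complex (p t) (q t)); first exact/(CcP hG).
rewrite [e]splitr EFinD /l2sq; apply: leeD.
  apply: le_trans pE; rewrite le_eqVlt; apply/orP; left.
  by apply/eqP; congr sqint; apply/funext => t /=; case: (g t).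
apply: le_trans qE; rewrite le_eqVlt; apply/orP; left.
by apply/eqP; congr sqint; apply/funext => t /=; case: (g t).
Qed.

Lemma conv_l2_bound (g : borel G -> R[i]) : cmeasurable g ->
  (l2sq (lam y) g < +oo)%E -> (forall t, ~ src_fiber y t -> g t = 0) ->
  cmeasurable (twisted_conv lam omega F g : borel G -> R[i]) /\
  (l2sq (lam y) (twisted_conv lam omega F g) <= C%:E * l2sq (lam y) g)%E.
Proof.
move=> mg goo g0; pose r n : R := n.+1%:R^-1.
have r0 n : 0 < r n by rewrite invr_gt0 ltr0n.
have rcvg : r n @[n --> \oo] --> (0 : R) by exact: cvg_harmonic.
have /choice[u uP] : forall n, exists un : G -> R[i], Cc un /\
    (l2sq (lam y) (g \- un)%R <= (r n ^+ 2)%:E)%E.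
  move=> n; have [un ? ?] := Cc_dense_l2sq mg goo (exprn_gt0 2 (r0 n)).
  by exists un.
have Cu n : Cc (u n) by have [] := uP n.
have ug n : (l2sq (lam y) (g \- u n)%R <= (r n ^+ 2)%:E)%E by have [] := uP n.
have mu n : cmeasurable (u n : borel G -> R[i]) by exact: Cc_cmeasurable.
have uoo n : (l2sq (lam y) (u n) < +oo)%E.
  by have [Phi _ ->//] := l2sq_Cc (Cu n); rewrite ltry.
pose f n := twisted_conv lam omega F (u n).
pose f0 := twisted_conv lam omega F g.
have Cf n : Cc (f n) by exact: twisted_conv_Cc.
have fcvg t : src_fiber y t ->
    (complex.Re (f n t) @[n --> \oo] --> complex.Re (f0 t)) /\
    (complex.Im (f n t) @[n --> \oo] --> complex.Im (f0 t)).
  move=> ty; have [K K0 KP] := conv_pointwise_le ty.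
  have rK : r n * K @[n --> \oo] --> 0.
    by rewrite -[X in _ --> X](mul0r K); apply: cvgM; [exact: rcvg|exact: cvg_cst].
  have nK e : 0 < e -> \forall n \near \oo, r n * K <= e.
    move=> e0; have /cvgrPdist_le /(_ _ e0) := rK; apply: filterS => n.
    by rewrite sub0r normrN ler_norml => /andP[].
  have P n := KP _ _ _ mg (mu n) goo (uoo n) (r0 n) (ug n).
  split; apply/cvgrPdist_le => e /nK; apply: filterS => n; apply: le_trans.
    by have [] := P n.
  by have [] := P n.
(* Measurability of the convolution with a general L^2 function: on the closed fiber it is a
   pointwise limit of the continuous [f n], and elsewhere it is 0. *)
have mf0 (h : R[i] -> R) : h 0 = 0 ->
    (forall n, measurable_fun setT (fun t : borel G => h (f n t))) ->
    (forall t, src_fiber y t -> h (f n t) @[n --> \oo] --> h (f0 t)) ->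
    measurable_fun setT (fun t : borel G => h (f0 t)).
  move=> h0 mhf hcvg; have -> : (fun t : borel G => h (f0 t)) =
      ((fun t => h (f0 t)) \_ D).
    apply/funext => t; rewrite patchE; case: ifPn => // /negP tD.
    by rewrite /f0 twisted_conv_off ?h0// => ty; apply: tD; rewrite inE.
  suff mh : measurable_fun D (fun t : borel G => h (f0 t)).
    by move/(measurable_restrictT _ mD) : mh.
  have mhfD n : measurable_fun D (fun t : borel G => h (f n t)).
    exact: (measurable_funTS (mhf n)).
  exact: (@measurable_fun_cvg _ _ _ D (fun n t => h (f n t)) (fun t => h (f0 t))
    mhfD hcvg).
have Mf n : cmeasurable (f n : borel G -> R[i]) by exact: Cc_cmeasurable.
have Mf0 : cmeasurable (f0 : borel G -> R[i]).
  split; [apply: (mf0 (@complex.Re R)) => // [n|t ty]|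
          apply: (mf0 (@complex.Im R)) => // [n|t ty]].
  - by have [] := Mf n.
  - by have [] := fcvg t ty.
  - by have [] := Mf n.
  - by have [] := fcvg t ty.
split => //.
pose N n t : \bar R := (normc (f n t) ^+ 2)%:E.
have Ncvg t : D t -> N n t @[n --> \oo] --> (normc (f0 t) ^+ 2)%:E.
  move=> Dt; have [cr ci] := fcvg t Dt.
  apply: cvg_EFin; first exact: nearW.
  have -> : fine \o (N ^~ t) = (fun n =>
      complex.Re (f n t) * complex.Re (f n t) +
      complex.Im (f n t) * complex.Im (f n t)).
    by apply/funext => n; rewrite -[LHS]/(normc (f n t) ^+ 2) normc_sqE !expr2.
  by rewrite normc_sqE !expr2; apply: cvgD; apply: cvgM.
have mN n : measurable_fun D (N n).
  apply: measurable_funTS; apply: measurable_sq.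
  by have [? ?] := Mf n; exact: measurable_normc.
pose E := fine (l2sq (lam y) g).
have EE : l2sq (lam y) g = E%:E.
  by rewrite fineK// ge0_fin_numE// l2sq_ge0.
(* The weighted inequality with weight [r n], for [u n = g + (u n - g)]. As the error is at most
   [r n ^+ 2], its large factor leaves [r n ^+ 2 + r n], so [c n] tends to [C * E]. *)
pose c n := C * ((1 + r n) * E + (1 + (r n)^-1) * (r n) ^+ 2).
have Nc n : (\int[lam y]_(t in D) N n t <= (c n)%:E)%E.
  rewrite -l2sq_fiber//; apply: (le_trans (FC (Cu n))).
  rewrite /c EFinM lee_wpmul2l ?lee_fin//.
  have -> : l2sq (lam y) (u n) = l2sq (lam y) (g \+ (u n \- g))%R.
    by congr l2sq; apply/funext => t /=; rewrite addrC subrK.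
  have mug : cmeasurable (u n \- g : borel G -> R[i]) by exact: cmeasurableB.
  apply: (le_trans (l2sqD_weighted (lam y) (r0 n) mg mug)).
  rewrite EE -EFinM [leRHS]EFinD; apply: leeD => //; rewrite EFinM lee_wpmul2l//.
    by rewrite lee_fin addr_ge0// invr_ge0 ltW.
  apply: le_trans (ug n); rewrite /l2sq le_eqVlt; apply/orP; left; apply/eqP.
  by congr (_ + _)%E; apply: eq_integral => t _ /=;
    case: (u n t) (g t) => [? ?] [? ?] /=; congr EFin; ring.
have ccvg : c n @[n --> \oo] --> C * E.
  have -> : c = (fun n => C * (E + (r n * E + (r n * r n + r n)))).
    apply/funext => n; rewrite /c; congr (_ * _).
    by field; rewrite gt_eqF.
  have -> : C * E = C * (E + (0 * E + (0 * 0 + 0))) by ring.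
  apply: cvgM; first exact: cvg_cst.
  apply: cvgD; first exact: cvg_cst.
  apply: cvgD; first by apply: cvgM; [exact: rcvg|exact: cvg_cst].
  by apply: cvgD; [apply: cvgM; exact: rcvg|exact: rcvg].
rewrite EE -EFinM (l2sq_fiber hG haar uy Mf0).
apply: (@le_trans _ _ (\int[lam y]_(t in D) limn_einf (fun n => N n t))%E).
  rewrite le_eqVlt; apply/orP; left; apply/eqP; apply: eq_integral => t.
  by rewrite inE => /Ncvg /cvg_limn_einf_sup[->].
apply: le_trans (fatou (lam y) mD mN _) _; first by move=> n t _; rewrite lee_fin sqr_ge0.
have cE : (c n)%:E @[n --> \oo] --> (C * E)%:E by apply: cvg_EFin => //; exact: nearW.
rewrite limn_einf_lim -(cvg_lim _ cE)//.
apply: lee_lim; [exact: is_cvg_einfs|by apply/cvg_ex; exists (C * E)%:E|].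
apply: nearW => n; apply: le_trans (Nc n).
by apply: ereal_inf_lbound; exists n => /=.
Qed.

End L2Bound.
End Bound.

(** * Faithfulness *)

Section RealNorm.
Context (R : realType) (V : normedModType R[i]).

(* Norms of normedModType R[i] take their values in R[i]. *)
Definition rnorm (v : V) : R := complex.Re `|v|.

Lemma rnormE (v : V) : `|v| = (rnorm v)%:C%C.
Proof.
have := normr_ge0 v; rewrite /rnorm; case: `|v| => p q.
by rewrite lecE /= => /andP[/eqP -> _].
Qed.

Lemma rnorm_ge0 (v : V) : 0 <= rnorm v.
Proof. by have := normr_ge0 v; rewrite rnormE lecR. Qed.

Lemma ler_rnormD (u v : V) : rnorm (u + v) <= rnorm u + rnorm v.
Proof. by rewrite -lecR rmorphD /= -!rnormE ler_normD. Qed.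

Lemma rnormN (v : V) : rnorm (- v) = rnorm v.
Proof. by rewrite /rnorm normrN. Qed.

Lemma rnormZ (k : R) (v : V) : 0 <= k -> rnorm (k%:C%C *: v) = k * rnorm v.
Proof.
move=> k0; have : (rnorm (k%:C%C *: v))%:C%C = (k * rnorm v)%:C%C :> R[i].
  by rewrite -rnormE normrZ rnormE rmorphM /= ger0_norm// lecR.
by case.
Qed.

Lemma rnorm_eq0 (v : V) : rnorm v = 0 -> v = 0.
Proof. by move=> v0; apply/normr0_eq0; rewrite rnormE v0. Qed.

(** The linear map [f] supplies homogeneity, while [g] keeps the form in which it occurs under
    [opnorm]. *)
Lemma rnorm_le_opnorm (f : {linear V -> V}) (g : V -> V) (e : R) :
  (forall v, g v = f v) -> (opnorm g <= e%:E)%E ->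
  forall v, rnorm (g v) <= e * rnorm v.
Proof.
move=> gf ge v; have [v0|v0] := eqVneq (rnorm v) 0.
  rewrite (rnorm_eq0 v0) gf linear0 /rnorm !normr0 /=; lra.
have v1 : 0 < rnorm v by rewrite lt_def v0 rnorm_ge0.
have k0 : 0 <= (rnorm v)^-1 by rewrite invr_ge0 ltW.
pose u := ((rnorm v)^-1)%:C%C *: v.
have u1 : rnorm u = 1 by rewrite rnormZ// mulVf.
have : ((rnorm (g u))%:E <= e%:E)%E.
  apply: le_trans ge; apply: ereal_sup_ubound.
  by exists u => //=; rewrite rnormE u1.
rewrite lee_fin gf linearZ /= -gf rnormZ// mulrC ler_pdivrMr//.
Qed.

Lemma opnorm_le (g : V -> V) (e : R) :
  (forall v, rnorm v <= 1 -> rnorm (g v) <= e) -> (opnorm g <= e%:E)%E.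
Proof.
move=> ge; apply: ge_ereal_sup => _ [v /= v1 <-]; rewrite lee_fin; apply: ge.
by rewrite -lecR -rnormE.
Qed.

End RealNorm.

Section L2Class.
Context d (T : measurableType d) (R : realType) (mu : {measure set T -> \bar R}).
Local Open Scope quotient_scope.

Lemma L2class_pi (u : T -> R[i]) (up : u \in l2pred mu) :
  L2class mu u = \pi_(L2 mu) (MkL2fun up).
Proof. by rewrite /L2class insubT. Qed.

Lemma rnorm_pi (u : L2fun mu) :
  rnorm (\pi_(L2 mu) u : L2 mu) = fine (l2norm mu u).
Proof. by rewrite /rnorm [`|_|]L2norm_pi. Qed.

End L2Class.

(** * The regular representation on classes of functions *)

Section RegularRepresentation.
Context (R : realType) (G : topGroupoidType).
Hypotheses (hG : hausdorff_space G) (lcG : locally_compact [set: G]).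
Variable lam : G -> {measure set (borel G) -> \bar R}.
Hypothesis haar : right_haar_system lam.
Variable omega : G -> G -> R[i].
Hypothesis cocycle : continuous_2cocycle omega.
Local Open Scope quotient_scope.

Lemma Cc_l2pred (y : G) (u : G -> R[i]) : unit_space G y -> Cc u ->
  (u : borel G -> R[i]) \in l2pred (lam y).
Proof.
move=> uy Cu; apply/l2predE; split; first exact: Cc_cmeasurable.
by have [Phi _ ->//] := l2sq_Cc hG haar Cu; rewrite ltry.
Qed.

Definition Cc_L2 (y : G) (u : G -> R[i]) (uy : unit_space G y) (Cu : Cc u) :
  L2 (lam y) := \pi_(L2 (lam y)) (MkL2fun (Cc_l2pred uy Cu)).

Section Fiber.
Variables (y : G) (uy : unit_space G y).

Lemma l2sq_patch (v : borel G -> R[i]) : cmeasurable v ->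
  cmeasurable (patch (fun=> 0) (src_fiber y) v : borel G -> R[i]) /\
  l2sq (lam y) (patch (fun=> 0) (src_fiber y) v) = l2sq (lam y) v.
Proof.
move=> [mr mi]; have mD := @fiber_borel G hG y.
have restr (h : borel G -> R) : measurable_fun setT h ->
    measurable_fun setT (h \_ (src_fiber y : set (borel G))).
  move=> mh; have mhD : measurable_fun (src_fiber y : set (borel G)) h.
    exact: measurable_funTS.
  by move/(measurable_restrictT _ mD) : mhD.
have mp : cmeasurable (patch (fun=> 0) (src_fiber y) v : borel G -> R[i]).
  split.
    have -> : (fun t : borel G => complex.Re (patch (fun=> 0) (src_fiber y) v t)) =
        (fun t : borel G => complex.Re (v t)) \_ (src_fiber y : set (borel G)).
      by apply/funext => t; have [ty|ty] := pselect (src_fiber y t);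
        rewrite /patch; [rewrite !mem_set|rewrite !memNset].
    exact: restr.
  have -> : (fun t : borel G => complex.Im (patch (fun=> 0) (src_fiber y) v t)) =
      (fun t : borel G => complex.Im (v t)) \_ (src_fiber y : set (borel G)).
    by apply/funext => t; have [ty|ty] := pselect (src_fiber y t);
        rewrite /patch; [rewrite !mem_set|rewrite !memNset].
  exact: restr.
split => //; rewrite !l2sq_fiber//.
by apply: eq_integral => t; rewrite inE => ty; rewrite /patch mem_set.
Qed.

(** [regular_rep] convolves with a representative cut to the fiber. The cut does not alter the norm,
    as the measure is carried by the fiber, and the bound for Cc(G) has been extended to exactly
    such functions. *)
Lemma regular_rep_opnorm (F : G -> R[i]) (C : R) : Cc F -> 0 <= C ->
  (forall u, Cc u -> (l2sq (lam y) (twisted_conv lam omega F u) <=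
     (C ^+ 2)%:E * l2sq (lam y) u)%E) ->
  (opnorm (@regular_rep R G lam omega y F) <= C%:E)%E.
Proof.
move=> CF C0 FC; apply: opnorm_le => v.
rewrite -[v]reprK rnorm_pi reprK => v1.
have /l2predE[mv voo] := valP (repr v : L2fun (lam y)).
rewrite /regular_rep /L2fun_of.
set g := patch _ _ _.
have [mg gE] := l2sq_patch mv.
have goo : (l2sq (lam y) g < +oo)%E by rewrite gE.
have g0 t : ~ src_fiber y t -> g t = 0.
  by move=> ty; rewrite /g /patch memNset.
have [mFg Fg] := conv_l2_bound hG lcG haar cocycle uy CF (sqr_ge0 C) FC mg goo g0.
(* Square-integrability rules out the default value 0 of [L2class]. *)
have Fgp : twisted_conv lam omega F g \in l2pred (lam y).
  apply/l2predE; split => //; apply: le_lt_trans Fg _.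
  by rewrite lte_mul_pinfty ?lee_fin ?sqr_ge0.
rewrite (L2class_pi Fgp) rnorm_pi.
have : (l2norm (lam y) (twisted_conv lam omega F g) <= C%:E * l2norm (lam y) g)%E.
  by rewrite le_l2norm.
have -> : l2norm (lam y) g = l2norm (lam y) (repr v).
  by rewrite !l2norm_l2sq// gE.
have f1 := fin_l2norm (MkL2fun Fgp).
have f2 := fin_l2norm (repr v : L2fun (lam y)).
rewrite -(fineK f1) -(fineK f2) -EFinM lee_fin => /le_trans; apply.
by rewrite -[leRHS]mulr1 ler_wpM2l.
Qed.

(** The representative chosen in the class of [w] may differ from [w] on a null set. The pointwise
    estimate, at L^2 distance 0, shows that the convolutions nevertheless agree everywhere on the
    fiber. *)
Lemma regular_rep_Cc (F w : G -> R[i]) (CF : Cc F) (Cw : Cc w) :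
  regular_rep omega F (Cc_L2 uy Cw) =
  Cc_L2 uy (twisted_conv_Cc hG lcG haar cocycle CF Cw).
Proof.
set p := MkL2fun (Cc_l2pred uy Cw).
have ae_pw := repr_pi_L2 p.
rewrite /regular_rep /L2fun_of /Cc_L2 -/p.
set v := repr _ in ae_pw *; set g := patch _ _ _.
have /l2predE[mv voo] := valP v.
have [mg gE] := l2sq_patch mv.
have goo : (l2sq (lam y) g < +oo)%E by rewrite gE.
have g0 t : ~ src_fiber y t -> g t = 0.
  by move=> ty; rewrite /g /patch memNset.
have mw : cmeasurable (w : borel G -> R[i]) by exact: Cc_cmeasurable.
have woo : (l2sq (lam y) w < +oo)%E.
  by have /l2predE[] := Cc_l2pred uy Cw.
have mD := @fiber_borel G hG y.
have ae_D : {ae lam y, forall t, src_fiber y t}.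
  exists (~` src_fiber y : set (borel G)); split => //.
    exact: measurableC.
  exact: haar_fiber haar _ uy.
have ae_gw : {ae lam y, forall t, g t = w t}.
  apply: filterS2 ae_pw ae_D => t vw ty.
  by rewrite /g /patch mem_set// -[RHS]/(l2val p t) -vw.
have gw0 : l2sq (lam y) (g \- w)%R = 0%E.
  have [mr mi] := cmeasurableB mg mw.
  have E (h : R[i] -> R) : h 0 = 0 ->
      measurable_fun setT (fun t : borel G => h ((g \- w) t)) ->
      sqint (lam y) (fun t => h ((g \- w) t)) = 0%E.
    move=> h0 mh; rewrite /sqint.
    transitivity (\int[lam y]_t (cst 0%E) t)%E; last exact: integral0.
    apply: ae_eq_integral => //.
    - exact: measurable_sq.
    - have H : {ae lam y, forall t, setT t -> ((h ((g \- w) t)) ^+ 2)%:E = cst 0%E t}.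
        move: ae_gw; apply: (@filterS _ (almost_everywhere (lam y))) => t gw _ /=.
        by rewrite gw subrr h0 expr0n.
      exact: H.
  by rewrite /l2sq (E (@complex.Re R))// (E (@complex.Im R))// adde0.
have convE t : src_fiber y t ->
    twisted_conv lam omega F g t = twisted_conv lam omega F w t.
  move=> ty; have [K K0 KP] := conv_pointwise_le hG haar cocycle uy CF ty.
  (* The distance being 0, the estimate holds for every positive [r]; the choice [e / (K + 1)] also
     covers [K = 0]. *)
  have le0 (z : R) : (forall r, 0 < r -> `|z| <= r * K) -> z = 0.
    move=> zr; apply/eqP; rewrite -normr_le0; apply/ler_addgt0Pr => e e0.
    rewrite add0r; apply: (le_trans (zr (e / (K + 1)) _)).
      by rewrite divr_gt0// ltr_wpDl.
    by rewrite mulrAC ler_pdivrMr ?ltr_wpDl// ler_pM2l// lerDl.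
  have Q r : 0 < r -> (l2sq (lam y) (g \- w)%R <= (r ^+ 2)%:E)%E.
    by move=> r0; rewrite gw0 lee_fin sqr_ge0.
  have e1 := le0 _ (fun r r0 => (KP g w r mg mw goo woo r0 (Q r r0)).1).
  have e2 := le0 _ (fun r r0 => (KP g w r mg mw goo woo r0 (Q r r0)).2).
  move: e1 e2; case: (twisted_conv _ _ _ g t) (twisted_conv _ _ _ w t) => [a b] [c e] /=.
  by move=> /eqP; rewrite subr_eq0 => /eqP -> /eqP; rewrite subr_eq0 => /eqP ->.
have Cv := twisted_conv_Cc hG lcG haar cocycle CF Cw.
have FgE : twisted_conv lam omega F g =
    patch (fun=> 0) (src_fiber y) (twisted_conv lam omega F w).
  apply/funext => t; have [ty|ty] := pselect (src_fiber y t).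
    by rewrite /patch mem_set// convE.
  by rewrite /patch memNset//; exact: twisted_conv_off ty.
have /l2predE[mFw Fwoo] := Cc_l2pred uy Cv.
have [mFg Fgoo] := l2sq_patch mFw.
have Fgp : twisted_conv lam omega F g \in l2pred (lam y).
  by apply/l2predE; rewrite FgE Fgoo.
rewrite (L2class_pi Fgp); apply/eqP/pi_L2P.
move: ae_D; apply: (@filterS _ (almost_everywhere (lam y))) => t ty /=.
by rewrite FgE /patch mem_set.
Qed.

End Fiber.

(** The difference is written with [(-1) *: g] to match [completionD] and [completionZ], through
    which [emb] is computed on it. *)
Lemma twisted_convB (f g w : G -> R[i]) (xi : G) : Cc f -> Cc g -> Cc w ->
  twisted_conv lam omega (f + (-1) *: g) w xi =
  twisted_conv lam omega f w xi - twisted_conv lam omega g w xi.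
Proof.
move=> Cf Cg Cw.
have mD := @fiber_borel G hG (src xi).
have [fr fi] := conv_kernel_fiber_continuous cocycle xi Cf.1 Cw.1.
have [gr gi] := conv_kernel_fiber_continuous cocycle xi Cg.1 Cw.1.
have ifr := conv_kernel_integrable hG haar Cf Cw (erefl _) fr.
have ifi := conv_kernel_integrable hG haar Cf Cw (erefl _) fi.
have igr := conv_kernel_integrable hG haar Cg Cw (erefl _) gr.
have igi := conv_kernel_integrable hG haar Cg Cw (erefl _) gi.
have kE t : (f + (-1) *: g) (gmul xi (ginv t)) * w t * omega (gmul xi (ginv t)) t =
    conv_kernel omega f w (xi, t) - conv_kernel omega g w (xi, t).
  by rewrite /conv_kernel /= !fctE /GRing.scale /=; ring.
rewrite /twisted_conv /Cintegral.
have subE (a b c e : R) : Complex a b - Complex c e = Complex (a - c) (b - e) by [].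
rewrite subE; congr (Complex _ _).
  rewrite -RintegralB//; apply: eq_Rintegral => t _; rewrite kE /conv_kernel /=.
  by move: (f _ * _ * _) (g _ * _ * _) => [? ?] [? ?].
rewrite -RintegralB//; apply: eq_Rintegral => t _; rewrite kE /conv_kernel /=.
by move: (f _ * _ * _) (g _ * _ * _) => [? ?] [? ?].
Qed.

Lemma CcB (f g : G -> R[i]) : Cc f -> Cc g -> Cc (f + (-1) *: g).
Proof.
move=> /(CcP hG)[fr fi] /(CcP hG)[gr gi]; apply/(CcP hG); split.
  rewrite (_ : (fun x => _) = (fun x => complex.Re (f x)) \+
    (fun x => -1 * complex.Re (g x))); first by apply: ccfunD => //; exact: ccfunZ.
  apply/funext => x; rewrite !fctE /GRing.scale /=.
  by case: (f x) (g x) => [? ?] [? ?] /=; ring.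
rewrite (_ : (fun x => _) = (fun x => complex.Im (f x)) \+
  (fun x => -1 * complex.Im (g x))); first by apply: ccfunD => //; exact: ccfunZ.
apply/funext => x; rewrite !fctE /GRing.scale /=.
by case: (f x) (g x) => [? ?] [? ?] /=; ring.
Qed.

End RegularRepresentation.

(** * Faithfulness on the reduced algebra *)

Section Faithful.
Context (R : realType) (G : topGroupoidType).
Hypotheses (hG : hausdorff_space G) (lcG : locally_compact [set: G]).
Variable lam : G -> {measure set (borel G) -> \bar R}.
Hypothesis haar : right_haar_system lam.
Variable omega : G -> G -> R[i].
Hypothesis cocycle : continuous_2cocycle omega.
Variables (A : cStarAlgType R) (emb : (G -> R[i]) -> A).
Hypothesis completionA : reduced_completion lam omega emb.
Variables (x z : G) (zx : groupoid_orbit z x).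
Hypothesis dense_orbit : unit_space G `<=` closure (groupoid_orbit z).
Variable Pi : A -> bounded_operator (L2 (lam x)).
Hypothesis extPi : regular_extension omega emb Pi.

Let ux : unit_space G x.
Proof. by have [t _ <-] := zx; exact: unit_space_rng. Qed.

Lemma embB (f g : G -> R[i]) : Cc f -> Cc g ->
  emb (f + (-1) *: g) = emb f - emb g.
Proof.
move=> Cf Cg; have Cg' : Cc ((-1) *: g).
  have C0 : Cc ((fun=> 0) : G -> R[i]) by apply/(CcP hG); split; exact: ccfun0.
  by have := CcB hG C0 Cg; rewrite (_ : (fun=> 0) = 0 :> (G -> R[i]))// add0r.
rewrite (completionD completionA)// (completionZ completionA)//.
by rewrite scaleN1r.
Qed.

(** One function has to be close to [a] both in [A] and under [Pi]. The second condition is also a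
    neighbourhood of [a], by the norm continuity in [regular_extension], so density is applied to
    the intersection. *)
Lemma approx_emb (a : A) (e : R) : 0 < e -> exists f, [/\ Cc f,
  rnorm (emb f - a) <= e & forall v, rnorm (Pi (emb f) v - Pi a v) <= e * rnorm v].
Proof.
move=> e0; have [_ /(_ a) cPi] := extPi.
have n1 : \forall b \near a, (opnorm (fun u => Pi b u - Pi a u)%R < e%:E)%E.
  apply: (cPi [set r | (r < e%:E)%E]).
  by apply: open_nbhs_nbhs; split; [exact: open_ereal_lt_ereal|rewrite /= lte_fin].
have n2 : \forall b \near a, `|a - b| < e%:C%C.
  have : (id b) @[b --> a] --> a by exact: cvg_id.
  by move=> /cvgrPdist_lt; apply; rewrite ltcR.
have n12 : nbhs a
    ([set b | (opnorm (fun u => Pi b u - Pi a u)%R < e%:E)%E] `&`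
     [set b | `|a - b| < e%:C%C]) by exact: filterI.
have [b [Ub [f Cf fb]]] := completion_dense completionA
  (ex_intro _ a (nbhs_singleton (nbhs_interior n12))) (@open_interior _ _).
exists f; have /= [] := interior_subset Ub; rewrite -fb => p1 p2; split => //.
  rewrite -rnormN opprB -lecR -rnormE; exact: ltW.
move=> v.
pose h : {linear L2 (lam x) -> L2 (lam x)} := (Pi (emb f) \- Pi a)%R.
exact: (@rnorm_le_opnorm _ _ h (fun u => Pi (emb f) u - Pi a u) _ (fun=> erefl) (ltW p1)).
Qed.

Lemma Pi_faithful (a b : A) : (forall v, Pi a v = Pi b v) -> a = b.
Proof.
move=> ab; apply/eqP; rewrite -subr_eq0; apply/eqP/rnorm_eq0/eqP.
rewrite -normr_le0 ger0_norm ?rnorm_ge0//; apply/ler_addgt0Pr => e e0.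
rewrite add0r; have e4 : 0 < e / 4 by rewrite divr_gt0.
have [f [Cf fa fP]] := approx_emb a e4.
have [g [Cg gb gP]] := approx_emb b e4.
pose h := f + (-1) *: g; have Ch : Cc h by exact: CcB.
have e2 : 0 <= e / 2 by rewrite divr_ge0 ?ltW.
have hx w : Cc w -> (l2sq (lam x) (twisted_conv lam omega h w) <=
    ((e / 2) ^+ 2)%:E * l2sq (lam x) w)%E.
  move=> Cw.
  have Chw := twisted_conv_Cc hG lcG haar cocycle Ch Cw.
  rewrite -le_l2norm//; [|exact: Cc_cmeasurable..].
  pose v := Cc_L2 hG haar ux Cw.
  have Pf : Pi (emb f) v = Cc_L2 hG haar ux (twisted_conv_Cc hG lcG haar cocycle Cf Cw).
    by rewrite extPi.1// regular_rep_Cc.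
  have Pg : Pi (emb g) v = Cc_L2 hG haar ux (twisted_conv_Cc hG lcG haar cocycle Cg Cw).
    by rewrite extPi.1// regular_rep_Cc.
  (* Linearity enters here, at the level of convolutions of functions of Cc(G), where it is an
     identity between integrals. *)
  have hE : Cc_L2 hG haar ux Chw = Pi (emb f) v - Pi (emb g) v.
    rewrite Pf Pg /Cc_L2 -pi_oppr -pi_addr.
    apply/eqP/pi_L2P; apply: aeW => t; rewrite l2valB /=.
    exact: twisted_convB.
  have : rnorm (Cc_L2 hG haar ux Chw) <= e / 2 * rnorm v.
    rewrite hE; have -> : Pi (emb f) v - Pi (emb g) v =
        (Pi (emb f) v - Pi a v) + - (Pi (emb g) v - Pi b v).
      by rewrite ab opprB addrA subrK.
    apply: (le_trans (ler_rnormD _ _)); rewrite rnormN.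
    apply: (le_trans (lerD (fP v) (gP v))).
    by rewrite -mulrDl (_ : e / 4 + e / 4 = e / 2)//; lra.
  rewrite /v /Cc_L2 !rnorm_pi -lee_fin EFinM !fineK//; exact: fin_l2norm.
have hy := conv_bound_dense hG lcG haar cocycle Ch dense_orbit zx hx.
have hn : rnorm (emb h) <= e / 2.
  rewrite -lee_fin (completion_norm completionA Ch).
  apply: ge_ereal_sup => _ [y uy <-].
  by apply: regular_rep_opnorm => // u Cu; exact: hy.
move: hn; rewrite /h embB// => hn.
have -> : a - b = - (emb f - a) + ((emb f - emb g) + (emb g - b)).
  by rewrite opprB !addrA !subrK.
apply: (le_trans (ler_rnormD _ _)); rewrite rnormN.
have := ler_rnormD (emb f - emb g) (emb g - b).
lra.
Qed.

End Faithful.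

(** * Double centralizers of a C*-algebra *)

Section Multipliers.
Context (R : realType) (A : cStarAlgType R).

(** Take [c] to be the adjoint of [a] in the C*-identity. *)
Lemma cmul_eq0_left (a : A) : (forall c, cmul c a = 0) -> a = 0.
Proof.
move=> a0; apply/eqP; rewrite -normr_eq0 -sqrf_eq0 -cnorm_star a0.
by rewrite normr0.
Qed.

Lemma cmulBr (a b c : A) : cmul a (b - c) = cmul a b - cmul a c.
Proof. by rewrite cmulDr -scaleN1r cmulZr scaleN1r. Qed.

Lemma cmul_injl (a b : A) : (forall c, cmul c a = cmul c b) -> a = b.
Proof.
move=> ab; apply/eqP; rewrite -subr_eq0; apply/eqP/cmul_eq0_left => c.
by rewrite cmulBr ab subrr.
Qed.

Lemma cmul_injr (a b : A) : (forall c, cmul a c = cmul b c) -> a = b.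
Proof.
move=> ab; rewrite -[a]cstarK -[b]cstarK; congr cstar; apply: cmul_injl => c.
by rewrite -[c]cstarK -!cstarM ab.
Qed.

(** The left map determines the right one: [rmult m a] is known through its products
    [cmul (rmult m a) c], which equal [cmul a (lmult m c)]. *)
Lemma multiplier_eq (m n : multiplier A) :
  (forall a, lmult m a = lmult n a) -> m = n.
Proof.
move=> lmn; have rmn a : rmult m a = rmult n a.
  by apply: cmul_injr => c; rewrite -!lrmult lmn.
case: m n lmn rmn => [l r h] [l' r' h'] /= /funext ll' /funext rr'.
move: h h'; rewrite ll' rr' => h h'; congr Multiplier; exact: Prop_irrelevance.
Qed.

(** It comes down to [lmult m (cmul a b) = cmul (lmult m a) b]. This is not part of the definition
    of a multiplier; it follows by multiplying on the left by [c], moving [m] to [c] as [rmult m],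
    and moving it back. *)
Lemma multiplier_mul_embed (m : multiplier A) (a : A) :
  multiplier_mul m (multiplier_embed a) = multiplier_embed (lmult m a).
Proof.
apply: multiplier_eq => b /=; apply: cmul_injl => c.
by rewrite lrmult !cmulA lrmult.
Qed.

End Multipliers.

Theorem proposition2p4 (R : realType) (G : topGroupoidType)
    (hausdorffG : hausdorff_space G)
    (locally_compactG : locally_compact [set: G])
    (sigma_compactG : sigma_compact G)
    (lam : G -> {measure set (borel G) -> \bar R})
    (haar : right_haar_system lam)
    (omega : G -> G -> R[i]) (cocycle : continuous_2cocycle omega)
    (A : cStarAlgType R) (emb : (G -> R[i]) -> A)
    (completionA : reduced_completion lam omega emb)
    (M : set G) (orbitM : exists2 z : G, unit_space G z & M = groupoid_orbit z)
    (denseM : unit_space G `<=` closure M)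
    (x : G) (Mx : M x)
    (Pi : A -> bounded_operator (L2 (lam x)))
    (extPi : regular_extension omega emb Pi) :
  injective Pi /\
  (~ unital A ->
    forall PiM : multiplier A -> bounded_operator (L2 (lam x)),
      multiplier_extension Pi PiM -> injective PiM).
Proof.
have [z uz ME] := orbitM; rewrite {}ME in denseM Mx.
have faithful a b : (forall v, Pi a v = Pi b v) -> a = b.
  exact: (Pi_faithful hausdorffG locally_compactG haar cocycle completionA Mx).
split=> [a b ab|_ PiM extM m n mn]; first by apply: faithful => v; rewrite ab.
apply: multiplier_eq => a; apply: faithful => v.
rewrite -!(multiplier_extension_embed extM) -!multiplier_mul_embed.
by rewrite !(multiplier_extensionM extM) mn.
Qed.
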